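(* Let $X_\bullet$ be an ordered augmented semi-simplicial object in the Burnside category. Then the explicit operations $$\smile_i\colon C^p(X_\bullet;\mathbb{F}_2)\otimes C^q(X_\bullet;\mathbb{F}_2)\longrightarrow C^{p+q-i}(X_\bullet;\mathbb{F}_2),\qquad (\alpha\smile_i\beta)(\sigma)=(\alpha\otimes\beta)(\nabla_i(\sigma)),\qquad i\in\mathbb{Z},$$ where $\nabla_i$ is the homomorphism defined in the context, form a stable symmetric multiplication on the cochain complex $C^*(X_\bullet;\mathbb{F}_2)$, i.e. for all $i\in\mathbb{Z}$ and all cochains $\alpha,\beta$, $$d(\alpha\smile_i\beta)=d\alpha\smile_i\beta+\alpha\smile_i d\beta+\alpha\smile_{i-1}\beta+\beta\smile_{i-1}\alpha .$$ The multiplication is natural in the following sense: for every free order-preserving map $f\colon X_\bullet\to Y_\bullet$ of ordered augmented semi-simplicial objects in the Burnside category, and all cochains $\alpha,\beta$ of $Y_\bullet$ and all $i$, $f^*(\alpha\smile_i\beta)=f^*(\alpha)\smile_i f^*(\beta)$. Moreover, if $X_\bullet$ is a semi-simplicial set, then these operations are the Steenrod cup-$i$ products, i.e. they are dual to $$x\longmapsto \sum_{U\in P_{n-i}(n)}\partial_{U^-}(x)\otimes\partial_{U^+}(x),\qquad x\in X_n .$$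
   Context: **Burnside category.** A locally finite span from a set $X$ to a set $Y$ is a set $Q$ with maps $\mathrm{source}\colon Q\to X$, $\mathrm{target}\colon Q\to Y$ such that $\mathrm{source}^{-1}(x)$ is finite for every $x$. A fibrewise bijection between two spans from $X$ to $Y$ is a bijection commuting with source and target. The composite of a span $Q$ from $X$ to $Y$ and a span $Q'$ from $Y$ to $Z$ is $Q'\circ Q=Q\times_Y Q'$; the identity span is $X=X=X$ (associativity and unit isomorphisms are suppressed). The Burnside $2$-category has sets as objects, locally finite spans as $1$-morphisms, fibrewise bijections as $2$-morphisms. For a commutative ring $R$, a span $Q$ induces $\mathcal{A}_R(Q)\colon R\langle X\rangle\to R\langle Y\rangle$, $x\mapsto\sum_{e\in \mathrm{source}^{-1}(x)}\mathrm{target}(e)$. A span is free if its source map is injective. **Objects.** $P_q(n)$ is the set of strictly increasing sequences of $q$ elements of $\{0,\ldots,n\}$ (i.e. $q$-element subsets). For disjoint $V,U\subset\{0,\dots,n\}$, $\psi_V(U)=\{u-|\{v\in V: v<u\}| : u\in U\}\subset\{0,\ldots,n-|V|\}$. An augmented semi-simplicial object in the Burnside category $X_\bullet$ consists of: a set $X_n$ for each $n\ge -1$; for each $n\geq -1$ and $U\in P_q(n)$ a locally finite span $\partial^n_U$ from $X_n$ to $X_{n-q}$ (the same symbol denotes its underlying set); for each partition $U=V_1\sqcup V_2$ with $V_1\in P_{q_1}(n)$ a fibrewise bijection $\mu^n_{V_1,V_2}\colon\partial^n_U\to\partial^{n-q_1}_{\psi_{V_1}(V_2)}\circ\partial^n_{V_1}$;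 such that $\partial^n_\emptyset$ is the identity span, $\mu_{\emptyset,V}$ and $\mu_{V,\emptyset}$ are identities, and for $U=V_1\sqcup V_2\sqcup V_3$ one has $(\mathrm{Id}\times\mu_{\psi_{V_1}(V_2),\psi_{V_1}(V_3)})\circ\mu_{V_1,V_2\cup V_3}=(\mu_{V_1,V_2}\times\mathrm{Id})\circ\mu_{V_1\cup V_2,V_3}$; this composite is denoted $\mu_{V_1,V_2,V_3}\colon\partial_U\to\partial_{\psi_{V_1\cup V_2}(V_3)}\circ\partial_{\psi_{V_1}(V_2)}\circ\partial_{V_1}$. It is ordered if each set $\partial^n_U$ is equipped with a total order. It is a semi-simplicial set if it comes from one: $X_{-1}=\emptyset$, and for $|U|\le n$ the source map of $\partial_U^n$ is bijective, so that $\partial_U^n$ is a function $X_n\to X_{n-|U|}$ (and a term involving $\partial^n_U$ with $|U|=n+1$ is zero). $C_*(X_\bullet;R)$ is the chain complex with $C_n=R\langle X_n\rangle$, $n\ge -1$, and $d_n=\sum_{i=0}^n(-1)^i\mathcal{A}_R(\partial^n_{\{i\}})$; $C^*(X_\bullet;R)$ is its dual. **Maps.** A map $f\colon X_\bullet\to Y_\bullet$ (structure of $Y_\bullet$ denoted $\bar\partial,\bar\mu$) consists of locally finite spans $f_n$ from $X_n$ to $Y_n$ and fibrewise bijections $f^n_U\colon f_{n-q}\circ\partial^n_U\to\bar\partial^n_U\circ f_n$ for $U\in P_q(n)$, with $f^n_\emptyset$ the identity and, for $U=V_1\sqcup V_2$, $\bar\mu_{V_1,V_2}\circ f_U=f_{V_1}\circ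 f^{n-|V_1|}_{\psi_{V_1}(V_2)}\circ\mu_{V_1,V_2}$ (suppressing identity factors). It induces chain maps $\mathcal{A}_R(f_n)$ and cochain maps $f^*$. It is free if every $f_n$ is a free span. For a free map and $x\in X_n$, $y\in Y_{n-q}$, the subsets of elements of $f_{n-q}\circ\partial^n_U$ and of $\bar\partial^n_U\circ f_n$ with source $x$ and target $y$ are totally ordered via their projections to $\partial^n_U$ and $\bar\partial^n_U$; a free map is order-preserving if each $f^n_U$ restricts to order-preserving bijections between these sets. **Sequences with repetitions.** $\mathcal{P}_q(n)$ is the set of non-decreasing sequences of length $q$ in $\{0,\ldots,n\}$ in which each number appears at most twice. For $U\in\mathcal{P}_q(n)$, $\dot U$ is the set of non-repeated entries, $\ddot U$ the set of repeated entries. If $\bar u_1<\dots<\bar u_m$ are the distinct entries of $U$, the index of a non-repeated entry $\bar u_i$ is $\bar u_i+i$. Then $U^+$ (resp. $U^-$) is the set consisting of $\ddot U$ and the non-repeated entries of even (resp. odd) index. So $U^+\cap U^-=\ddot U$ and $|U^+|+|U^-|=q$. **Good pairs and chains.** For $V_1\subset U$, $\lambda_{V_1}\colon\partial_U\to\partial_{V_1}$ is $\mu_{V_1,U\smallsetminus V_1}$ followed by projection. For disjoint $V_1,V_2\subset U$, $\lambda_{V_1,V_2}\colon\partial^n_U\to\partial^{n-|V_1|}_{\psi_{V_1}(V_2)}$ is $\mu_{V_1,V_2,U\smallsetminus(V_1\cup V_2)}$ followed by projection to the middle factor. Let $U,V\subset\{0,\ldots,n\}$, $(s,t)\in\partial_U\times\partial_V$.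 A pair $(W^\parallel,W^\circ)$ of disjoint subsets of $U\cap V$ is $(s,t)$-good if $\lambda_{W^\parallel}(s)=\lambda_{W^\parallel}(t)$ and $\lambda_{W^\parallel,W^\circ}(s)\ne\lambda_{W^\parallel,W^\circ}(t)$. A good pair is positive if either $n+|U|+|V|$ is even and $\lambda_{W^\parallel,W^\circ}(s)<\lambda_{W^\parallel,W^\circ}(t)$, or $n+|U|+|V|$ is odd and $\lambda_{W^\parallel,W^\circ}(s)>\lambda_{W^\parallel,W^\circ}(t)$. Write $(W_0^\parallel,W_0^\circ)\prec(W_1^\parallel,W_1^\circ)$ if $W_1^\circ=W_0^\circ\sqcup\{w\}$ for some $w$ and $W_1^\parallel=W_0^\parallel\smallsetminus\{w\}$. $\mathcal{O}_{s,t}(U\cap V)$ is the set of chains $(W_1^\parallel,W_1^\circ)\prec\dots\prec(W_r^\parallel,W_r^\circ)$ of $(s,t)$-good pairs of length $r=|U\cap V|$, and $\mathcal{O}_{s,t}(U\cap V)^+$ is the subset of chains all of whose entries are positive (if $U\cap V=\emptyset$ there is exactly one, empty, chain and it counts as positive). **Comultiplication.** $\nabla_k\colon C_*(X_\bullet;\mathbb{F}_2)\to C_*(X_\bullet;\mathbb{F}_2)\otimes C_*(X_\bullet;\mathbb{F}_2)$ is the degree $k$ homomorphism given on $x\in X_n$ by $$\nabla_k(x)=\sum_{U\in\mathcal{P}_{n-k}(n)}\ \sum_{\substack{(s,t)\in\partial_{U^-}\times\partial_{U^+}\\ \mathrm{source}(s)=\mathrm{source}(t)=x}}|\mathcal{O}_{s,t}(\ddot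 U)^+|\cdot\mathrm{target}(s)\otimes\mathrm{target}(t).$$
   Formalization: In the naturality clause, ''order-preserving'' is strengthened: f_U must preserve the order among all elements with the same source x, whatever their targets, not only among those with the same source x and target y; with the latter condition naturality is false. *)

(* Defs.v *)
From HB Require Import structures.
From mathcomp Require Import all_boot all_order all_algebra.
From mathcomp Require Import boolp classical_sets functions cardinality fsbigop.
From mathcomp Require Import fintype finset.
From mathcomp.multinomials Require Import freeg.

Set Implicit Arguments.
Unset Strict Implicit.
Unset Printing Implicit Defensive.

Import GRing.Theory.

Local Open Scope ring_scope.

(* {freeg K / R} is the free module R<K>, << x >> a basis element and         *)
(* fglift f the linear extension of f : K -> M.                               *)

Section FgliftLinear.
Context (R : nzRingType) (K : choiceType) (M : lmodType R) (f : K -> M).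

Fact fglift_is_linear : linear (fglift f).
Proof.
have fgliftB := @lift_is_additive R K M f.
have fglift0 : fglift f 0 = 0 by rewrite -(subrr 0) fgliftB subrr.
have fgliftN c : fglift f (- c) = - fglift f c.
  by rewrite -[- c]add0r fgliftB fglift0 add0r.
have fgliftD a b : fglift f (a + b) = fglift f a + fglift f b.
  by rewrite -[b in LHS]opprK fgliftB fgliftN opprK.
have fglift_sum (s : seq K) (F : K -> {freeg K / R}) :
    fglift f (\sum_(x <- s) F x) = \sum_(x <- s) fglift f (F x).
  by elim: s => [|x s IHs]; rewrite ?big_nil // !big_cons fgliftD IHs.
move=> a u v; rewrite fgliftD; congr (_ + _).
have -> : a *: u = \sum_(x <- dom u) << a * coeff x u *g x >> by [].
rewrite -[in RHS](freeg_sumE u) !fglift_sum scaler_sumr.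
by apply: eq_bigr => x _; rewrite !liftU scalerA.
Qed.

HB.instance Definition _ :=
  GRing.isLinear.Build R {freeg K / R} M *:%R (fglift f) fglift_is_linear.

End FgliftLinear.

(* -------------------------------------------------------------------------- *)
(* The Burnside 2-category; sets are choiceTypes.                             *)

Record span (X Y : choiceType) := Span {
  span_car :> choiceType;
  source : span_car -> X;
  target : span_car -> Y;
  source_finite : forall x, finite_set [set e | source e = x]%classic }.

Definition fibre (X Y : choiceType) (Q : span X Y) (x : X) : set Q :=
  [set e | source e = x]%classic.
Arguments fibre {X Y} Q x.

Section SpanComp.
Context (X Y Z : choiceType) (Q : span X Y) (Q' : span Y Z).

Definition comp_car : choiceType :=
  {e : (Q * Q')%type | target e.1 == source e.2}.

Fact comp_source_finite (x : X) :
  finite_set [set e : comp_car | source (val e).1 = x]%classic.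
Proof.
pose F := (\bigcup_(e in fibre Q x)
             ((fun e' => (e, e')) @` fibre Q' (target e)))%classic.
have finF : finite_set F.
  apply: bigcup_finite => [|e _]; first exact: source_finite.
  exact/finite_image/source_finite.
have inj : {in (val : comp_car -> _) @^-1` F &, injective val}%classic.
  by move=> ? ? _ _; apply: val_inj.
apply: sub_finite_set (finite_preimage inj finF).
case=> [[e e'] /= he] ex; exists e => //; exists e' => //.
by rewrite /fibre /= (eqP he).
Qed.

(* Q' o Q = Q x_Y Q', whose elements are the pairs (e, e'), e in Q, e' in Q'. *)
Definition span_comp : span X Z :=
  @Span X Z comp_car (fun e => source (val e).1) (fun e => target (val e).2)
    comp_source_finite.

End SpanComp.

Record fibrewise_bijection (X Y : choiceType) (P Q : span X Y) := FibBij {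
  fib_fun :> P -> Q;
  fib_bij : bijective fib_fun;
  fib_source : forall e, source (fib_fun e) = source e;
  fib_target : forall e, target (fib_fun e) = target e }.

(* Spans are only meaningful up to fibrewise bijection; being the identity    *)
(* span X = X = X means that the two legs are one and the same bijection.     *)
Definition identity_span (X : choiceType) (Q : span X X) : Prop :=
  bijective (@source X X Q) /\ @target X X Q =1 @source X X Q.

Definition free_span (X Y : choiceType) (Q : span X Y) : Prop :=
  injective (@source X Y Q).

(* A_R(Q) : R<X> -> R<Y>; the sum ranges over the finite set source^-1(x).    *)
Definition span_linear (R : nzRingType) (X Y : choiceType) (Q : span X Y) :
    {freeg X / R} -> {freeg Y / R} :=
  fglift (fun x => \sum_(e \in fibre Q x) (<< target e >> : {freeg Y / R})).

HB.instance Definition _ (R : nzRingType) (X Y : choiceType) (Q : span X Y) :=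
  GRing.Linear.on (span_linear (R := R) Q).

(* -------------------------------------------------------------------------- *)
(* Index conventions. Degrees are shifted by one so as to start at 0: a       *)
(* family indexed by m : nat lives in degree n = m - 1 >= -1, and             *)
(* {0, ..., n} is 'I_m. A subset U of {0, ..., n} with q = n - n' elements    *)
(* gives the face operator from degree n to degree n' = k - 1; face m k is    *)
(* thus P_q(n), the codegree k being recorded in the type to keep targets     *)
(* X_(n-q) free of casts.                                                     *)

Definition face (m k : nat) : Type := {U : {set 'I_m} | (#|U| + k == m)%N}.

Fact face_of_subproof (m : nat) (U : {set 'I_m}) :
  (#|U| + (m - #|U|) == m)%N.
Proof. by rewrite subnKC // -[m in (_ <= m)%N]card_ord max_card. Qed.

Definition face_of (m : nat) (U : {set 'I_m}) : face m (m - #|U|) :=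
  exist _ U (face_of_subproof U).

Fact empty_face_subproof (m : nat) : (#|@set0 'I_m| + m == m)%N.
Proof. by rewrite cards0. Qed.

Definition empty_face (m : nat) : face m m := exist _ set0 (empty_face_subproof m).

(* psi_V(U), for U disjoint from V and l = m - #|V|                           *)
Definition psi (m l : nat) (V U : {set 'I_m}) : {set 'I_l} :=
  [set j : 'I_l |
    [exists u in U, val j == (u - #|[set v in V | (v < u)%N]|)%N]].

(* U = V |_| V2 and W = psi_V(V2), i.e. d_U is compared with d_W o d_V.       *)
Definition splits (m l k : nat) (U : face m k) (V : face m l) (W : face l k) :
    bool :=
  (val V \subset val U) && (val W == psi l (val V) (val U :\: val V)).

Lemma psiS (m l : nat) (V U U' : {set 'I_m}) :
  U \subset U' -> psi l V U \subset psi l V U'.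
Proof.
move=> sUU'; apply/subsetP => j; rewrite !inE => /existsP[u /andP[uU ju]].
by apply/existsP; exists u; rewrite ju andbT (subsetP sUU').
Qed.

Section Residue.
Context (m l k : nat) (U : face m k) (V : face m l).
Hypothesis sVU : val V \subset val U.

Fact residue_subproof :
  (#|psi l (val V) (val U :\: val V)| + k == l)%N.
Proof.
case: U V sVU => [U' /eqP cU] [V' /eqP cV] /= sVU'.
have lem : (l <= m)%N by rewrite -cV leq_addl.
have winj p q (le : (p <= q)%N) : injective (widen_ord le).
  by move=> x y /(congr1 val) /= /val_inj.
pose low (u : 'I_m) := [set w : 'I_m | (w < u)%N].
have card_low u : #|low u| = u :> nat.
  rewrite -[RHS]card_ord -(card_imset _ (winj _ _ (ltnW (ltn_ord u)))).
  apply: eq_card => w; rewrite inE; apply/idP/imsetP => [wu|[v _ ->]] /=.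
    by exists (Ordinal wu) => //; apply: val_inj.
  exact: ltn_ord.
pose g u := #|low u :\: V'|.
have gE (u : 'I_m) : (u - #|[set v in V' | (v < u)%N]|)%N = g u.
  rewrite -[X in (X - _)%N]card_low -(cardsID V' (low u)) addnC.
  rewrite (_ : [set v in V' | _] = low u :&: V') ?addnK //.
  by apply/setP => v; rewrite !inE andbC.
have gl (u : 'I_m) : u \notin V' -> (g u < l)%N.
  move=> uV; have -> : l = #|~: V'|.
    by apply/eqP; rewrite -(eqn_add2l #|V'|) cV cardsC card_ord.
  apply/proper_card/properP; split; first by apply/subsetP => w /setDP[_]; rewrite inE.
  by exists u; rewrite !inE ?uV // ltnn andbF.
have g_mono (u v : 'I_m) : u \notin V' -> (u < v)%N -> (g u < g v)%N.
  move=> uV uv; apply/proper_card/properP; split.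
    by apply/subsetP => w; rewrite !inE => /andP[-> /= /ltn_trans]; apply.
  by exists u; rewrite !inE ?uV ?uv // ltnn.
have g_inj : {in U' :\: V' &, injective g}.
  move=> u v /setDP[_ uV] /setDP[_ vV] guv; apply: val_inj.
  case: (ltngtP u v) => // [/(g_mono _ _ uV)|/(g_mono _ _ vV)];
    by rewrite guv ltnn.
have g_lt u : (g u < m)%N.
  apply: leq_ltn_trans (ltn_ord u); rewrite -[leqRHS]card_low.
  exact/subset_leq_card/subsetDl.
pose G u := Ordinal (g_lt u).
have Ginj : {in U' :\: V' &, injective G}.
  by move=> u v uD vD /(congr1 val) /=; apply: g_inj.
have <- : #|U' :\: V'| = #|psi l V' (U' :\: V')|.
  rewrite -(card_in_imset Ginj) -(card_imset _ (winj _ _ lem)).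
  apply: eq_card => j; apply/imsetP/imsetP => [[u uD ->]|[i + ->]].
    have uV : u \notin V' by case/setDP: uD.
    exists (Ordinal (gl u uV)); last exact: val_inj.
    by rewrite inE; apply/existsP; exists u; rewrite uD gE eqxx.
  rewrite inE => /existsP[u /andP[uD /eqP iu]].
  by exists u => //; apply: val_inj; rewrite /= iu gE.
rewrite cardsD (setIidPr sVU') -(eqn_add2l #|V'|) cV addnA subnKC ?cU //.
exact: subset_leq_card.
Qed.

Definition residue : face l k :=
  exist _ (psi l (val V) (val U :\: val V)) residue_subproof.

Fact residue_splits : splits U V residue.
Proof. by rewrite /splits sVU eqxx. Qed.

End Residue.

(* -------------------------------------------------------------------------- *)
(* Augmented semi-simplicial objects in the Burnside category. A partition    *)
(* U = V1 |_| V2 is presented as splits U V W with W = psi_V1(V2); the        *)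
(* cocycle condition for U = V1 |_| V2 |_| V3 takes V12 = V1 u V2,            *)
(* W2 = psi_V1(V2), W23 = psi_V1(V2 u V3) and W3 = psi_V12(V3), the latter    *)
(* being also psi_W2(psi_V1(V3)).                                             *)

Record burnside_object := BurnsideObject {
  cells : nat -> choiceType;
  bd : forall m k, face m k -> span (cells m) (cells k);
  mu : forall m l k (U : face m k) (V : face m l) (W : face l k),
    splits U V W -> fibrewise_bijection (bd U) (span_comp (bd V) (bd W));
  bd_empty : forall m, identity_span (bd (empty_face m));
  mu_empty_l : forall m k (V : face m k) (h : splits V (empty_face m) V) s,
    (val (mu h s)).2 = s;
  mu_empty_r : forall m k (V : face m k) (h : splits V V (empty_face k)) s,
    (val (mu h s)).1 = s;
  mu_assoc : forall m l j k (U : face m k) (V1 : face m l) (V12 : face m j)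
      (W2 : face l j) (W23 : face l k) (W3 : face j k)
      (h1_23 : splits U V1 W23) (h2_3 : splits W23 W2 W3)
      (h12_3 : splits U V12 W3) (h1_2 : splits V12 V1 W2) (s : bd U),
    let a := val (mu h1_23 s) in
    let b := val (mu h12_3 s) in
    (a.1, val (mu h2_3 a.2)) =
    ((val (mu h1_2 b.1)).1, ((val (mu h1_2 b.1)).2, b.2)) }.
Arguments bd X {m k} U : rename.
Arguments mu {X m l k U V W} h : rename.

Record ordered_object := OrderedObject {
  ordered_base :> burnside_object;
  ord_le : forall m k (U : face m k), rel (bd ordered_base U);
  ord_le_total : forall m k (U : face m k), total (@ord_le m k U);
  ord_le_anti : forall m k (U : face m k), antisymmetric (@ord_le m k U);
  ord_le_trans : forall m k (U : face m k), transitive (@ord_le m k U) }.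
Arguments ord_le {X m k U} s t : rename.

Definition ord_lt (X : ordered_object) (m k : nat) (U : face m k) :
    rel (bd X U) :=
  fun s t => (s != t) && ord_le s t.

(* The condition k > 0 is |U| <= n. There is nothing to say for |U| = n + 1,  *)
(* as d_U is then a span to the empty set.                                    *)
Definition semi_simplicial_set (X : burnside_object) : Prop :=
  (cells X 0 -> False) /\
  (forall m k (U : face m k), (0 < k)%N ->
     bijective (@source (cells X m) (cells X k) (bd X U))).

(* -------------------------------------------------------------------------- *)
(* Maps. An element of the composite f_k o d_U is a pair (s, a) with          *)
(* s in d_U, a in f_k and target s = source a. In obj_map_mu, c = (s, a),     *)
(* mu(s) = (s1, s2), and c2 = (s2, a), c1 = (s1, b) with f_W(c2) = (b, _) are *)
(* the elements at which the identity factors allow f_W and f_V to be         *)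
(* evaluated; they exist and are unique, mu and f_W being fibrewise.          *)

Record object_map (X Y : burnside_object) := ObjectMap {
  obj_map : forall m, span (cells X m) (cells Y m);
  obj_map_bd : forall m k (U : face m k),
    fibrewise_bijection (span_comp (bd X U) (obj_map k))
                        (span_comp (obj_map m) (bd Y U));
  obj_map_empty : forall m (c : span_comp (bd X (empty_face m)) (obj_map m)),
    (val (obj_map_bd (empty_face m) c)).1 = (val c).2;
  obj_map_mu : forall m l k (U : face m k) (V : face m l) (W : face l k)
      (h : splits U V W) (c : span_comp (bd X U) (obj_map k))
      (c2 : span_comp (bd X W) (obj_map k))
      (c1 : span_comp (bd X V) (obj_map l)),
    val c2 = ((val (mu h (val c).1)).2, (val c).2) ->
    val c1 = ((val (mu h (val c).1)).1, (val (obj_map_bd W c2)).1) ->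
    let c' := val (obj_map_bd U c) in
    (c'.1, val (mu h c'.2)) =
    ((val (obj_map_bd V c1)).1,
     ((val (obj_map_bd V c1)).2, (val (obj_map_bd W c2)).2)) }.
Arguments obj_map {X Y} f m : rename.
Arguments obj_map_bd {X Y} f {m k} U : rename.

Definition free_map (X Y : burnside_object) (f : object_map X Y) : Prop :=
  forall m, free_span (obj_map f m).

(* For free f an element of f_k o d_U or d_U o f_m with given source is       *)
(* determined by its component in d_U, so that these sets of elements are     *)
(* totally ordered through that component. All the elements with a common     *)
(* source are compared, whatever their targets: nabla compares elements of    *)
(* d_U with the same source and possibly distinct targets, and naturality     *)
(* would fail if only elements with a common target were compared.            *)
Definition order_preserving (X Y : ordered_object) (f : object_map X Y) : Prop :=
  forall m k (U : face m k) (c c' : span_comp (bd X U) (obj_map f k)),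
    source c = source c' -> ord_le (val c).1 (val c').1 ->
    ord_le (val (obj_map_bd f U c)).2 (val (obj_map_bd f U c')).2.

(* -------------------------------------------------------------------------- *)
(* Chains. C_*(X; R) is the direct sum over n >= -1 of R<X_n>, i.e. the free  *)
(* module on the disjoint union of the X_n; C_* (x) C_* is the free module on *)
(* pairs of simplices, x (x) y being << (x, y) >>.                            *)

Definition simplex (X : burnside_object) : choiceType :=
  {m : nat & cells X m}.

Definition simplex_of (X : burnside_object) (m : nat) (x : cells X m) :
    simplex X :=
  Tagged (fun m => cells X m) x.

Definition chain (R : nzRingType) (X : burnside_object) : lmodType R :=
  {freeg (simplex X) / R}.

Definition chain_of (R : nzRingType) (X : burnside_object) (m : nat) :
    {freeg (cells X m) / R} -> chain R X :=
  fglift (fun x => << simplex_of x >> : chain R X).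

(* the R-linear extension of maps given on each X_n                           *)
Definition chain_lift (R : nzRingType) (X : burnside_object) (M : lmodType R)
    (F : forall m, cells X m -> M) : {linear chain R X -> M} :=
  fglift (fun z : simplex X => F (tag z) (tagged z)).

(* A_R(d_U)(x), as an element of C_*(X; R)                                    *)
Definition face_chain (R : nzRingType) (X : burnside_object) (m : nat)
    (U : {set 'I_m}) (x : cells X m) : chain R X :=
  chain_of (span_linear (bd X (face_of U)) << x >>).

Definition boundary (R : nzRingType) (X : burnside_object) :
    {linear chain R X -> chain R X} :=
  chain_lift (fun m x => \sum_(i < m) (-1) ^+ i *: face_chain R [set i] x).

Definition chain_map (R : nzRingType) (X Y : burnside_object)
    (f : object_map X Y) : {linear chain R X -> chain R Y} :=
  chain_lift (fun m x => chain_of (span_linear (obj_map f m) << x >>)).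

Definition chain2 (R : nzRingType) (X : burnside_object) : lmodType R :=
  {freeg (simplex X * simplex X)%type / R}.

Definition tensor (R : nzRingType) (X : burnside_object) (a b : chain R X) :
    chain2 R X :=
  fglift (fun x => fglift (fun y => << (x, y) >> : chain2 R X) b) a.

(* -------------------------------------------------------------------------- *)
(* Cochains over F_2.                                                         *)

Notation F2 := 'F_2.

(* The linear dual of C_*, i.e. the product of the C^p; the elements of C^p   *)
(* are those vanishing on X_n for n != p.                                     *)
Definition cochain (X : burnside_object) : Type :=
  {linear chain F2 X -> F2^o}.

Definition has_degree (X : burnside_object) (p : int) (a : cochain X) : Prop :=
  forall (m : nat) (x : cells X m), m%:Z - 1 != p -> a << simplex_of x >> = 0.

Definition coboundary (X : burnside_object) (a : cochain X) : cochain X :=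
  a \o boundary F2 X.

Definition pullback (X Y : burnside_object) (f : object_map X Y)
    (a : cochain Y) : cochain X :=
  a \o chain_map F2 f.

Definition cochain_tensor (X : burnside_object) (a b : cochain X) :
    {linear chain2 F2 X -> F2^o} :=
  fglift (fun xy => a << xy.1 >> * b << xy.2 >> : F2^o).

(* The operation (a, b) |-> (a (x) b) o D dual to D : C_* -> C_* (x) C_*.     *)
Definition dual_operation (X : burnside_object)
    (D : {linear chain F2 X -> chain2 F2 X}) (a b : cochain X) : cochain X :=
  cochain_tensor a b \o D.

Definition stable_symmetric_multiplication (X : burnside_object)
    (cup : int -> cochain X -> cochain X -> cochain X) : Prop :=
  [/\ forall i (a a' b : cochain X), cup i (a \+ a') b =1 cup i a b \+ cup i a' b,
      forall i (a b b' : cochain X), cup i a (b \+ b') =1 cup i a b \+ cup i a b',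
      forall i p q (a b : cochain X), has_degree p a -> has_degree q b ->
        has_degree (p + q - i) (cup i a b)
    & forall i (a b : cochain X),
        coboundary (cup i a b) =1
          cup i (coboundary a) b \+ cup i a (coboundary b)
          \+ cup (i - 1) a b \+ cup (i - 1) b a].

Section Sequences.
Context (m : nat).
Implicit Types (U : seq 'I_m) (u : 'I_m).

Definition at_most_twice U : bool :=
  sorted leq [seq val u | u <- U] && [forall u, (count_mem u U <= 2)%N].

Definition strictly_increasing U : bool := sorted ltn [seq val u | u <- U].

Definition repeated U u : bool := count_mem u U == 2.

(* For non-decreasing U, undup U lists the distinct entries increasingly; the *)
(* index counts positions in it from 1.                                       *)
Definition entry_index U u : nat := u + (index u (undup U)).+1.

Definition plus_part U : {set 'I_m} :=
  [set u in U | repeated U u || ~~ odd (entry_index U u)].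

Definition minus_part U : {set 'I_m} :=
  [set u in U | repeated U u || odd (entry_index U u)].

End Sequences.

Section Lambda.
Context (X : burnside_object) (m l k : nat) (U : face m k) (V : face m l).
Hypothesis sVU : val V \subset val U.

Definition lam (s : bd X U) : bd X V := (val (mu (residue_splits sVU) s)).1.

(* the other component of mu_(V, U \ V)(s)                                    *)
Definition lam_rest (s : bd X U) : bd X (residue sVU) :=
  (val (mu (residue_splits sVU) s)).2.

End Lambda.

(* the middle component of (Id x mu_(psi_V1 V2, psi_V1 V3)) o mu_(V1, V2 u V3)*)
Definition lam2 (X : burnside_object) (m l k : nat) (U : face m k)
    (V1 : face m l) (V2 : {set 'I_m}) (sV1U : val V1 \subset val U)
    (sV2U : psi l (val V1) V2 \subset psi l (val V1) (val U :\: val V1))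
    (s : bd X U) : bd X (face_of (psi l (val V1) V2)) :=
  @lam X _ _ _ (residue sV1U) (face_of (psi l (val V1) V2)) sV2U
    (lam_rest sV1U s).

(* pairs (W^par, W^circ) of disjoint subsets of A                             *)
Definition disjoint_pair (m : nat) (A : {set 'I_m}) : finType :=
  {P : {set 'I_m} * {set 'I_m} |
    [&& P.1 \subset A, P.2 \subset A & [disjoint P.1 & P.2]]}.

Section DisjointPairs.
Context (m : nat) (A : {set 'I_m}).
Implicit Types P : disjoint_pair A.

Definition par P : {set 'I_m} := (val P).1.
Definition circ P : {set 'I_m} := (val P).2.

(* w need not lie in par P0, in which case par P1 = par P0.                   *)
Definition prec : rel (disjoint_pair A) := fun P0 P1 =>
  [exists w, [&& w \notin circ P0, circ P1 == w |: circ P0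
               & par P1 == par P0 :\ w]].

Context (X : burnside_object) (U : {set 'I_m}) (sAU : A \subset U).

Fact par_sub P : val (face_of (par P)) \subset val (face_of U).
Proof. by case/and3P: (valP P) => sP _ _; apply: subset_trans sP sAU. Qed.

Fact circ_sub P (l : nat) :
  psi l (par P) (circ P) \subset psi l (par P) (U :\: par P).
Proof.
apply: psiS; case/and3P: (valP P) => _ sP dP.
by rewrite subsetD (subset_trans sP sAU) disjoint_sym.
Qed.

(* lambda_(W^par) and lambda_(W^par, W^circ)                                  *)
Definition lam_par P (s : bd X (face_of U)) : bd X (face_of (par P)) :=
  lam (par_sub P) s.

Definition lam_circ P (s : bd X (face_of U)) :
    bd X (face_of (psi (m - #|par P|) (par P) (circ P))) :=
  @lam2 X _ _ _ (face_of U) (face_of (par P)) (circ P) (par_sub P) (circ_sub P _) s.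

End DisjointPairs.

Section GoodPairs.
Context (X : ordered_object) (m : nat) (U V : {set 'I_m}).
Context (s : bd X (face_of U)) (t : bd X (face_of V)).
Implicit Types P : disjoint_pair (U :&: V).

Let sU P := lam_circ (subsetIl U V) P s.
Let tV P := lam_circ (subsetIr U V) P t.

Definition good P : bool :=
  (lam_par (subsetIl U V) P s == lam_par (subsetIr U V) P t) && (sU P != tV P).

(* the parity of n + |U| + |V|, for n = m - 1                                 *)
Definition positive P : bool :=
  good P && if odd (m + #|U| + #|V|) then ord_lt (sU P) (tV P)
            else ord_lt (tV P) (sU P).

Definition good_chains : {set #|U :&: V|.-tuple (disjoint_pair (U :&: V))} :=
  [set c : #|U :&: V|.-tuple _ | sorted (@prec m (U :&: V)) c & all good c].

Definition positive_chains : {set #|U :&: V|.-tuple (disjoint_pair (U :&: V))} :=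
  [set c in good_chains | all positive c].

End GoodPairs.

(* -------------------------------------------------------------------------- *)
(* Comultiplications. On X_n, n = m - 1, the length n - i of the sequences is *)
(* an integer, and there are no sequences of negative length.                 *)

Definition nabla (X : ordered_object) (i : int) :
    {linear chain F2 X -> chain2 F2 X} :=
  chain_lift (fun m (x : cells X m) =>
    if m%:Z - 1 - i is Posz q then
      \sum_(U : q.-tuple 'I_m | at_most_twice U)
        \sum_(s \in fibre (bd X (face_of (minus_part U))) x)
          \sum_(t \in fibre (bd X (face_of (plus_part U))) x)
            #|positive_chains s t|%:R *:
              (<< (simplex_of (target s), simplex_of (target t)) >> : chain2 F2 X)
    else 0).

Definition cup (X : ordered_object) (i : int) (a b : cochain X) : cochain X :=
  dual_operation (nabla X i) a b.

Definition steenrod_nabla (X : burnside_object) (i : int) :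
    {linear chain F2 X -> chain2 F2 X} :=
  chain_lift (fun m (x : cells X m) =>
    if m%:Z - 1 - i is Posz q then
      \sum_(U : q.-tuple 'I_m | strictly_increasing U)
        tensor (face_chain F2 (minus_part U) x) (face_chain F2 (plus_part U) x)
    else 0).

(* Main.v *)
Require Import Defs.
From mathcomp Require Import all_boot all_order all_algebra.
From mathcomp Require Import boolp classical_sets functions cardinality fsbigop.
From mathcomp Require Import fintype finset.
From mathcomp Require Import ring.
From mathcomp.multinomials Require Import freeg.

Set Implicit Arguments.
Unset Strict Implicit.
Unset Printing Implicit Defensive.

Import Order.TTheory GRing.Theory.
Local Open Scope ring_scope.

(** Fix a simplex x of degree m - 1, subsets A and B of 'I_m, and s in d_A, t in
    d_B with source x.  Everything is controlled by the simplicial complex E of the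
    subsets W of A :&: B with lambda_W(s) = lambda_W(t): since mu is bijective, a
    pair (W, Z) of disjoint subsets is good iff W is in E and W :|: Z is not
    ([positiveE]), and since the pieces of ∂ are totally ordered, exactly one of
    the two signs applies to a good pair ([signed_good_xor]).

    Write c^e(W, Z) for the number modulo 2 of chains of #|Z| good pairs of sign e
    ending at (W, Z); when #|Z| is 0 put c^e(W, Z) = [W in E].  Dropping the last
    pair of a chain gives the recursion
      c^e(W, Z) = [(W, Z) is good of sign e] *
                  \sum_(w in Z) (c^e(W, Z :\ w) + c^e(w |: W, Z :\ w)),
    and the coefficient |O_{s,t}(A :&: B)^+| of the comultiplication is
    c^e(set0, A :&: B), with e the parity of m + #|A| + #|B|
    ([card_positive_chains]).  The sum in the recursion is a boundary operator whose
    square vanishes modulo 2, because two elements can be removed in two orders.  An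
    induction on #|Z| then shows that this sum does not depend on the sign, which
    gives ([chain_count_boundary])
      c^+(W, Z) + c^-(W, Z) = \sum_(w in Z) (c^-(W, Z :\ w) + c^-(w |: W, Z :\ w)).

    For W empty and Z = C := A :&: B this is the Leibniz rule where C is concerned.
    The terms c^-(set0, C :\ w) come from applying the boundary to one of the two
    tensor factors: w becomes a non-repeated entry, lying in the factor prescribed by
    the parity of its index.  The terms c^-({w}, C :\ w) come from the comultiplication
    of the boundary of x: a common first face r of s and t at w contributes iff
    lambda_w(s) = lambda_w(t), and chains for the remaining pieces are chains for
    (s, t) with w added to the first entry of every pair ([signed_count_back]).  Both
    operations change the parity that fixes the sign, hence the minus signs.

    It remains to see which pairs (A, B) come from a sequence with repetitions
    ([admissible]: the non-repeated entries of odd index are those of A).  Removing a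
    non-repeated entry shifts the indices of the later ones, so the result is
    admissible iff the entries before it are rightly placed and those after it
    wrongly.  The number of such entries has the parity of
    [(A, B) admissible] + [(B, A) admissible] by a telescoping sum ([sum_switch]), and
    these two cases are the summands a cup_(i-1) b and b cup_(i-1) a, as exchanging s
    and t reverses the sign.  The result is [coefficient_identity].

    A free order-preserving map f sends the elements s over x whose target has an image
    under f bijectively and monotonically to the elements over the image of x, compatibly
    with mu, so it preserves E and the signs; the other elements s over x are annihilated
    by f.  In a semi-simplicial set every W is in E, there are no good pairs,
    and only the sequences without repetition contribute, each with coefficient 1. *)

(** * Renumbering the complement of a face *)

Section Gaps.

Fact card_compl_face m l (V : face m l) : l = #|~: val V|.
Proof.
apply/eqP; case: V => V /= /eqP cV.
by rewrite -(eqn_add2l #|V|) cV cardsC card_ord.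
Qed.

(** [psi] renumbers the complement of V by u |-> u - |{v in V : v < u}|; [gap V] is the
    inverse of this renumbering.  In terms of it psi_V is a preimage ([mem_psi]), and
    identities between renumberings become identities between compositions. *)
Definition gap m l (V : face m l) (j : 'I_l) : 'I_m :=
  @Order.enum_val _ 'I_m (mem (~: val V)) (cast_ord (card_compl_face V) j).

Lemma gap_le m l (V : face m l) (i j : 'I_l) : (gap V i <= gap V j)%N = (i <= j)%N.
Proof.
exact: (Order.le_enum_val (@le_total _ 'I_m)
  (cast_ord (card_compl_face V) i) (cast_ord (card_compl_face V) j)).
Qed.

Lemma gap_lt m l (V : face m l) (i j : 'I_l) : (gap V i < gap V j)%N = (i < j)%N.
Proof. by rewrite !ltnNge gap_le. Qed.

Lemma gap_inj m l (V : face m l) : injective (gap V).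
Proof.
move=> i j e; apply/val_inj/eqP; rewrite eqn_leq -!(gap_le V) e.
by rewrite leqnn.
Qed.

Lemma gapN m l (V : face m l) j : gap V j \notin val V.
Proof.
by have := @Order.enum_valP _ 'I_m (mem (~: val V))
  (cast_ord (card_compl_face V) j); rewrite inE.
Qed.

Lemma gap_onto m l (V : face m l) (u : 'I_m) :
  u \notin val V -> exists j, u = gap V j.
Proof.
move=> uV; have uA : u \in ~: val V by rewrite inE.
exists (cast_ord (esym (card_compl_face V)) (Order.enum_rank_in uA u)).
by rewrite /gap cast_ordKV Order.enum_rankK_in.
Qed.

Lemma card_ord_lt l (j : 'I_l) : #|[set i : 'I_l | (i < j)%N]| = j.
Proof.
have winj : injective (widen_ord (ltnW (ltn_ord j))).
  by move=> a b /(congr1 val) /= /val_inj.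
rewrite -[RHS]card_ord -(card_imset predT winj).
apply: eq_card => i; rewrite inE; apply/idP/imsetP => [ij|[i' _ ->]] /=.
  by exists (Ordinal ij) => //; apply: val_inj.
exact: ltn_ord.
Qed.

(** Both maps are increasing with values in the complement of V, which [gap V] fills, so
    that h is [gap V] after an increasing permutation of 'I_l, i.e. after the
    identity. *)
Lemma gap_unique m l (V : face m l) (h : 'I_l -> 'I_m) :
    (forall i j : 'I_l, (i < j)%N -> (h i < h j)%N) -> (forall i, h i \notin val V) ->
  h =1 gap V.
Proof.
move=> hlt hV.
have hle (i j : 'I_l) : (i <= j)%N -> (h i <= h j)%N.
  by rewrite leq_eqVlt => /orP[/eqP/val_inj->//|/hlt/ltnW].
have /choice[f fE] : forall i, exists j, h i = gap V j by move=> i; apply: gap_onto.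
have flt (i j : 'I_l) : (i < j)%N -> (f i < f j)%N.
  by move=> ij; rewrite -(gap_lt V) -!fE hlt.
have finj : injective f.
  move=> i j eij; apply: val_inj.
  case: (ltngtP i j) => // /flt; by rewrite eij ltnn.
have fij (i j : 'I_l) : (f i < f j)%N -> (i < j)%N.
  case: (ltngtP i j) => // [/flt /ltnW|/val_inj->]; last by rewrite ltnn.
  by rewrite leqNgt => /negbTE->.
move=> i; rewrite fE; congr (gap V _); apply: val_inj.
rewrite /= -[LHS]card_ord_lt -[RHS](card_ord_lt i) -[RHS](card_imset _ finj).
apply: eq_card => j; rewrite inE; apply/idP/imsetP => [ji|[k + ->]].
  have [g _ gK] := injF_bij finj.
  by exists (g j); rewrite ?gK // inE; apply: fij; rewrite gK.
by rewrite inE => /flt.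
Qed.

Lemma rank_gap m l (V : face m l) j :
  (gap V j - #|[set v in val V | (v < gap V j)%N]|)%N = j.
Proof.
set L := [set i : 'I_m | (i < gap V j)%N].
have -> : [set v in val V | (v < gap V j)%N] = L :&: val V.
  by apply/setP => v; rewrite !inE andbC.
rewrite -{1}(card_ord_lt (gap V j)) -/L -{1}(cardsID (val V) L) addKn.
rewrite -[RHS]card_ord_lt -(card_imset _ (@gap_inj _ _ V)).
apply: eq_card => u; rewrite !inE; apply/andP/imsetP => [[uV]|[i + ->]].
  by have [i ->] := gap_onto uV; rewrite gap_lt => ij; exists i; rewrite ?inE.
by rewrite inE gapN gap_lt.
Qed.

Lemma mem_psi m l (V : face m l) (U : {set 'I_m}) j :
  [disjoint val V & U] -> (j \in psi l (val V) U) = (gap V j \in U).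
Proof.
move=> dVU; rewrite inE; apply/existsP/idP => [[u /andP[uU /eqP ju]]|gU].
  have [i ui] : exists i, u = gap V i by apply/gap_onto/negbT/(disjointFl dVU).
  by move: ju; rewrite ui rank_gap => /val_inj->; rewrite -ui.
by exists (gap V j); rewrite gU rank_gap /=.
Qed.

Lemma splitsP m l k (U : face m k) (V : face m l) (W : face l k) :
  reflect (val V \subset val U /\ forall j, (j \in val W) = (gap V j \in val U))
          (splits U V W).
Proof.
have dVU : [disjoint val V & val U :\: val V].
  by rewrite disjoint_sym -setI_eq0 setIDAC setDIl setDv setI0.
apply: (iffP andP) => -[sVU] hW; split=> //.
  by move: hW => /eqP-> j; rewrite mem_psi // !inE gapN.
by apply/eqP/setP => j; rewrite hW mem_psi // !inE gapN.
Qed.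

Lemma splits_sub m l k (U : face m k) (V : face m l) (W : face l k) :
  splits U V W -> val V \subset val U.
Proof. by case/andP. Qed.

Lemma splits_mem m l k (U : face m k) (V : face m l) (W : face l k) j :
  splits U V W -> (j \in val W) = (gap V j \in val U).
Proof. by case/splitsP. Qed.

Lemma splits_val m l k (U : face m k) (V : face m l) (W : face l k) :
  splits U V W -> val U = val V :|: gap V @: val W.
Proof.
move=> h; apply/setP => u; rewrite inE.
have [uV|uV] /= := boolP (u \in val V).
  by rewrite (subsetP (splits_sub h)).
have [j ->] := gap_onto uV; rewrite mem_imset; last exact: gap_inj.
by rewrite (splits_mem _ h).
Qed.

Lemma gap_comp m l k (U : face m k) (V : face m l) (W : face l k) :
  splits U V W -> gap U =1 gap V \o gap W.
Proof.
move=> h j; apply/esym; apply: (gap_unique (h := gap V \o gap W)) => [a b ab|i] /=.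
  by rewrite !gap_lt.
by rewrite -(splits_mem _ h) gapN.
Qed.

(** Both sides say that W3 is a preimage of U, under gap V1 \o gap W2 and under gap V12,
    which agree.  This provides the hypotheses of the cocycle condition on mu. *)
Lemma splits_assoc m l j k (U : face m k) (V1 : face m l) (V12 : face m j)
    (W2 : face l j) (W23 : face l k) (W3 : face j k) :
    splits V12 V1 W2 -> splits U V1 W23 -> val V12 \subset val U ->
  splits W23 W2 W3 = splits U V12 W3.
Proof.
move=> h12 h123 sU.
have s2 : val W2 \subset val W23.
  apply/subsetP => i; rewrite (splits_mem _ h12) (splits_mem _ h123).
  exact: (subsetP sU).
apply/splitsP/splitsP => -[_ hW]; split=> // i; rewrite hW.
  by rewrite (splits_mem _ h123) (gap_comp h12).
by rewrite (splits_mem _ h123) (gap_comp h12).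
Qed.

Lemma join_face_subproof m l k (V : face m l) (W : face l k) :
  (#|val V :|: gap V @: val W| + k == m)%N.
Proof.
have dVW : val V :&: gap V @: val W = set0.
  apply/eqP; rewrite setI_eq0 disjoint_sym; apply/pred0P => u /=; apply/negP.
  by case/andP => /imsetP[i _ ->] h; have := gapN V i; rewrite h.
rewrite cardsU dVW cards0 subn0 card_imset; last exact: gap_inj.
by rewrite -addnA (eqP (valP W)) (eqP (valP V)).
Qed.

(** The face U such that V and W are the two steps of U, with the codegree of W for its
    codegree: elements of d_U and of d_W then have targets in the same type. *)
Definition join_face m l k (V : face m l) (W : face l k) : face m k :=
  exist _ (val V :|: gap V @: val W) (join_face_subproof V W).

Lemma join_splits m l k (V : face m l) (W : face l k) : splits (join_face V W) V W.
Proof.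
apply/splitsP; split=> [|j]; first exact: subsetUl.
by rewrite inE (negbTE (gapN V j)) mem_imset //; apply: gap_inj.
Qed.

End Gaps.

(** * Front and back factors of an element of a face span *)

Section Fronts.
Context (X : burnside_object).

(** The factor of mu(s) complementary to [lam]: mu(s) = (lam s, back s), whatever the
    presentation of the second step ([mu_front]). *)
Definition back m l k (U : face m k) (V : face m l) (W : face l k)
  (h : splits U V W) (s : bd X U) : bd X W := (val (mu h s)).2.

Lemma mu_front m l k (U : face m k) (V : face m l) (W : face l k)
    (h : splits U V W) (sVU : val V \subset val U) (s : bd X U) :
  (val (mu h s)).1 = lam sVU s.
Proof.
have eW : W = residue sVU by apply/val_inj/eqP; case/andP: h.
by move: h; rewrite /lam eW => h; rewrite (bool_irrelevance h (residue_splits sVU)).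
Qed.

Lemma lam_rest_back m l k (U : face m k) (V : face m l)
    (sVU : val V \subset val U) (s : bd X U) :
  lam_rest sVU s = back (residue_splits sVU) s.
Proof. by []. Qed.

Lemma lam_source m l k (U : face m k) (V : face m l)
    (sVU : val V \subset val U) (s : bd X U) : source (lam sVU s) = source s.
Proof. exact: (fib_source (mu (residue_splits sVU)) s). Qed.

Lemma back_target m l k (U : face m k) (V : face m l) (W : face l k)
    (h : splits U V W) (s : bd X U) : target (back h s) = target s.
Proof. exact: (fib_target (mu h) s). Qed.

Lemma back_source m l k (U : face m k) (V : face m l) (W : face l k)
    (h : splits U V W) (sVU : val V \subset val U) (s : bd X U) :
  source (back h s) = target (lam sVU s).
Proof. by rewrite -(mu_front h) -(eqP (valP (mu h s))). Qed.

Lemma front_back_inj m l k (U : face m k) (V : face m l) (W : face l k)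
    (h : splits U V W) (sVU : val V \subset val U) (s t : bd X U) :
  lam sVU s = lam sVU t -> back h s = back h t -> s = t.
Proof.
rewrite -!(mu_front h) => e1 e2; apply: (bij_inj (fib_bij (mu h))).
apply: val_inj; rewrite [LHS]surjective_pairing [RHS]surjective_pairing.
by congr (_, _).
Qed.

(** This and the next two lemmas are the three components of the cocycle condition: an
    element of d_U, split along V1 < V12 < U, has the same front, middle and back pieces
    whichever of V1 and V12 is split off first. *)
Lemma lam_lam m l j k (U : face m k) (V : face m j) (V1 : face m l)
    (sVU : val V \subset val U) (sV1V : val V1 \subset val V)
    (sV1U : val V1 \subset val U) (s : bd X U) :
  lam sV1V (lam sVU s) = lam sV1U s.
Proof.
have h12 := residue_splits sV1V; have h13 := residue_splits sV1U.
have h3 := residue_splits sVU.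
have h23 := h3; rewrite -(splits_assoc _ h12 h13 sVU) in h23.
have /= := mu_assoc h13 h23 h3 h12 s.
by rewrite !mu_front => -[<- _].
Qed.

Section Triple.
Context (m l j k : nat) (U : face m k) (V1 : face m l) (V12 : face m j).
Context (W2 : face l j) (W23 : face l k) (W3 : face j k).
Context (h1_23 : splits U V1 W23) (h12_3 : splits U V12 W3).
Context (h1_2 : splits V12 V1 W2) (h2_3 : splits W23 W2 W3).

Lemma lam_back (s2 : val W2 \subset val W23) (s12 : val V12 \subset val U) s :
  lam s2 (back h1_23 s) = back h1_2 (lam s12 s).
Proof.
have /= := mu_assoc h1_23 h2_3 h12_3 h1_2 s.
by rewrite (mu_front h12_3 s12) => -[_ e]; rewrite -(mu_front h2_3) /back /= e.
Qed.

Lemma back_back s : back h2_3 (back h1_23 s) = back h12_3 s.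
Proof. by have /= := mu_assoc h1_23 h2_3 h12_3 h1_2 s; case=> _ e; rewrite /back /= e. Qed.

End Triple.

End Fronts.
Arguments back {X m l k U V W} h s.

Section Compare.
Context (X : ordered_object).
Implicit Types (m k : nat).

(** The simplicial complex which governs goodness.  All the faces F with underlying set W
    are allowed, not only [face_of W], since the codegree of the faces met below is often
    only provably equal to m - #|W|; the choice is immaterial by [agreeE]. *)
Definition agree m k k' (U : face m k) (V : face m k') (s : bd X U) (t : bd X V)
    (W : {set 'I_m}) : bool :=
  `[< exists l (F : face m l) (sU : val F \subset val U) (sV : val F \subset val V),
        val F = W /\ lam sU s = lam sV t >].

(** lambda_(W, G :\: W)(s) < lambda_(W, G :\: W)(t): the middle piece of s, when s is split
    along W and G, is the back piece of the restriction of s to G ([lam_circE]). *)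
Definition less m k k' (U : face m k) (V : face m k') (s : bd X U) (t : bd X V)
    (W G : {set 'I_m}) : bool :=
  `[< exists l j (F1 : face m l) (F2 : face m j) (H : face l j)
       (h : splits F2 F1 H)
       (sU : val F2 \subset val U) (sV : val F2 \subset val V),
     [/\ val F1 = W, val F2 = G & ord_lt (back h (lam sU s)) (back h (lam sV t))] >].

Lemma face_codegree m k k' (F : face m k) (F' : face m k') :
  val F = val F' -> k = k'.
Proof.
case: F F' => [F /= /eqP e] [F' /= /eqP e'] eF; apply/eqP.
by rewrite -(eqn_add2l #|F|) {2}eF e e'.
Qed.

Lemma agreeE m k k' (U : face m k) (V : face m k') (s : bd X U) (t : bd X V)
    l (F : face m l) (sU : val F \subset val U) (sV : val F \subset val V) W :
  val F = W -> agree s t W = (lam sU s == lam sV t).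
Proof.
move=> eF; apply/asboolP/eqP => [|e]; last by exists l, F, sU, sV.
case=> l' [F' [sU' [sV' [eF' e]]]].
have el : l' = l by apply: (face_codegree (F := F') (F' := F)); rewrite eF eF'.
subst l'; have eFF : F' = F by apply: val_inj; rewrite eF eF'.
by subst F'; rewrite (bool_irrelevance sU sU') (bool_irrelevance sV sV').
Qed.

Arguments agreeE {m k k' U V} s t {l} F sU sV {W} _.

Lemma agree_subl m k k' (U : face m k) (V : face m k') (s : bd X U) (t : bd X V) W :
  agree s t W -> W \subset val U.
Proof. by move/asboolP => [l [F [sU [sV [<- _]]]]]. Qed.

Lemma agree_subr m k k' (U : face m k) (V : face m k') (s : bd X U) (t : bd X V) W :
  agree s t W -> W \subset val V.
Proof. by move/asboolP => [l [F [sU [sV [<- _]]]]]. Qed.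

Lemma lessE m k k' (U : face m k) (V : face m k') (s : bd X U) (t : bd X V)
    l j (F1 : face m l) (F2 : face m j) (H : face l j) (h : splits F2 F1 H)
    (sU : val F2 \subset val U) (sV : val F2 \subset val V) W G :
  val F1 = W -> val F2 = G ->
  less s t W G = ord_lt (back h (lam sU s)) (back h (lam sV t)).
Proof.
move=> eW eG; apply/asboolP/idP => [|e]; last by exists l, j, F1, F2, H, h, sU, sV.
case=> l' [j' [F1' [F2' [H' [h' [sU' [sV' [eW' eG' e]]]]]]]].
have el : l' = l by apply: (face_codegree (F := F1') (F' := F1)); rewrite eW eW'.
have ej : j' = j by apply: (face_codegree (F := F2') (F' := F2)); rewrite eG eG'.
subst l' j'; have eF1 : F1' = F1 by apply: val_inj; rewrite eW eW'.
have eF2 : F2' = F2 by apply: val_inj; rewrite eG eG'.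
subst F1' F2'.
have eH : H' = H.
  by apply/val_inj/setP => i; rewrite (splits_mem _ h) (splits_mem _ h').
subst H'; move: e.
by rewrite (bool_irrelevance sU sU') (bool_irrelevance sV sV') (bool_irrelevance h h').
Qed.

Arguments lessE {m k k' U V} s t {l j F1} F2 {H} h sU sV {W G} _ _.

(** A good pair (W, Z), with the smaller middle piece on the side of s if e and of t
    otherwise; it is positive iff e is the parity of m + #|U| + #|V| ([positiveE]). *)
Definition signed_good m k k' (U : face m k) (V : face m k') (s : bd X U) (t : bd X V)
    (e : bool) (W Z : {set 'I_m}) : bool :=
  [&& agree s t W, ~~ agree s t (W :|: Z) &
      if e then less s t W (W :|: Z) else less t s W (W :|: Z)].

Lemma agreeC m k k' (U : face m k) (V : face m k') (s : bd X U) (t : bd X V) W :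
  agree t s W = agree s t W.
Proof.
by apply/asboolP/asboolP => -[l [F [sU [sV [eF e]]]]]; exists l, F, sV, sU.
Qed.

Lemma signed_goodC m k k' (U : face m k) (V : face m k') (s : bd X U) (t : bd X V) e W Z :
  signed_good t s e W Z = signed_good s t (~~ e) W Z.
Proof. by rewrite /signed_good !(agreeC s t); case: e. Qed.

Lemma ord_ltC m k (U : face m k) (s t : bd X U) :
  s != t -> ord_lt t s = ~~ ord_lt s t.
Proof.
move=> st; rewrite /ord_lt eq_sym st /=.
have := ord_le_total s t; case: (boolP (ord_le s t)) => //= st' _.
by apply/negP => ts; move/eqP: st; apply; apply: ord_le_anti; rewrite st' ts.
Qed.

(** The order is total, and the middle pieces differ because, the front pieces on W being
    equal, equal middle pieces would make s and t agree on W :|: Z. *)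
Lemma signed_good_xor m k k' (U : face m k) (V : face m k') (s : bd X U) (t : bd X V) e W Z :
    W :|: Z \subset val U -> W :|: Z \subset val V ->
  signed_good s t e W Z (+) signed_good s t (~~ e) W Z =
  agree s t W && ~~ agree s t (W :|: Z).
Proof.
move=> sU sV; rewrite /signed_good.
case: (boolP (agree s t W)) => //= aW; case: (boolP (agree s t _)) => //= aG.
pose F1 := face_of W; pose F2 := face_of (W :|: Z).
have sF : val F1 \subset val F2 by apply: subsetUl.
have s2U : val F2 \subset val U := sU.
have s2V : val F2 \subset val V := sV.
have s1U : val F1 \subset val U := subset_trans sF s2U.
have s1V : val F1 \subset val V := subset_trans sF s2V.
have h := residue_splits sF.
rewrite (lessE s t F2 h s2U s2V) // (lessE t s F2 h s2V s2U) //.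
rewrite (@ord_ltC _ _ _ (back h (lam s2U s)) (back h (lam s2V t))).
  by case: e; case: (ord_lt _ _).
apply: contra aG => /eqP e2.
rewrite (agreeE s t F2 s2U s2V) //; apply/eqP.
apply: (front_back_inj (h := h) (sVU := sF)) => //.
rewrite (lam_lam _ _ s1U) (lam_lam _ _ s1V).
by apply/eqP; rewrite -(agreeE s t F1 s1U s1V (erefl _)).
Qed.

(** Good pairs only depend on the restrictions of s and t to faces containing both members
    of the pair, so the rest of s can be forgotten. *)
Section Restriction.
Context (m k k' j : nat) (U : face m k) (U' : face m j) (V : face m k').
Context (sU : val U' \subset val U) (s : bd X U) (t : bd X V).

Lemma agree_lam (W : {set 'I_m}) : W \subset val U' -> agree (lam sU s) t W = agree s t W.
Proof.
move=> sW.
have [sV|sV] := boolP (W \subset val V); last first.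
  by apply/idP/idP => /agree_subr; rewrite (negbTE sV).
pose F := face_of W.
have sF' : val F \subset val U' := sW.
have sFU : val F \subset val U := subset_trans sW sU.
have sFV : val F \subset val V := sV.
by rewrite (agreeE (lam sU s) t F sF' sFV) // (agreeE s t F sFU sFV) // (lam_lam _ _ sFU).
Qed.

Lemma less_lam (W G : {set 'I_m}) : G \subset val U' -> G \subset val V ->
  W \subset G ->
  less (lam sU s) t W G = less s t W G /\ less t (lam sU s) W G = less t s W G.
Proof.
move=> sG sV sWG; pose F := face_of G; pose F1 := face_of W.
have h := residue_splits (sWG : val F1 \subset val F).
have sF' : val F \subset val U' := sG.
have sFU : val F \subset val U := subset_trans sG sU.
have sFV : val F \subset val V := sV.
rewrite (lessE (lam sU s) t F h sF' sFV) // (lessE s t F h sFU sFV) //.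
rewrite (lessE t (lam sU s) F h sFV sF') // (lessE t s F h sFV sFU) //.
by rewrite (lam_lam _ _ sFU).
Qed.

Lemma signed_good_lam e (W Z : {set 'I_m}) :
    W :|: Z \subset val U' -> W :|: Z \subset val V ->
  signed_good (lam sU s) t e W Z = signed_good s t e W Z.
Proof.
move=> sG sV; rewrite /signed_good.
have [-> ->] := less_lam sG sV (subsetUl _ _).
by rewrite !agree_lam //; apply: subset_trans sG; apply: subsetUl.
Qed.

End Restriction.

(** Let s and t have the same front piece on J.  Restrictions of their back pieces to a
    subset W of 'I_l correspond to restrictions of s and t to J together with W, moved
    into the complement of J. *)
Section Link.
Context (m l k k' : nat) (U : face m k) (V : face m k') (J : face m l).
Context (WU : face l k) (WV : face l k').
Context (hU : splits U J WU) (hV : splits V J WV).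
Context (s : bd X U) (t : bd X V).
Hypothesis est : agree s t (val J).

Let lift (W : {set 'I_l}) : {set 'I_m} := val J :|: gap J @: W.

Section Faces.
Context (j : nat) (W : face l j).
Hypotheses (sWU : val W \subset val WU) (sWV : val W \subset val WV).

Lemma lift_subl : val (join_face J W) \subset val U.
Proof. by rewrite (splits_val hU); apply: setUS (imsetS _ sWU). Qed.

Lemma lift_subr : val (join_face J W) \subset val V.
Proof. by rewrite (splits_val hV); apply: setUS (imsetS _ sWV). Qed.

Lemma agree_back_face : agree (back hU s) (back hV t) (val W) = agree s t (lift (val W)).
Proof.
have h := join_splits J W.
have h3U := residue_splits lift_subl.
have h3V := residue_splits lift_subr.
have h23U := h3U; rewrite -(splits_assoc _ h hU lift_subl) in h23U.
have h23V := h3V; rewrite -(splits_assoc _ h hV lift_subr) in h23V.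
rewrite (agreeE _ _ W sWU sWV) // (agreeE s t (join_face J W) lift_subl lift_subr) //.
rewrite (lam_back hU h3U h h23U sWU lift_subl) (lam_back hV h3V h h23V sWV lift_subr).
apply/eqP/eqP => [e|->//].
have sJ := splits_sub h.
apply: (front_back_inj (h := h) (sVU := sJ)) => //.
have sJU := splits_sub hU; have sJV := splits_sub hV.
rewrite (lam_lam _ _ sJU) (lam_lam _ _ sJV).
by apply/eqP; rewrite -(agreeE s t J sJU sJV (erefl _)).
Qed.

End Faces.

Lemma agree_back (W : {set 'I_l}) : W \subset val WU -> W \subset val WV ->
  agree (back hU s) (back hV t) W = agree s t (lift W).
Proof. exact: (@agree_back_face _ (face_of W)). Qed.

Lemma less_back_face (j i : nat) (W : face l j) (G : face l i) :
    val W \subset val G -> val G \subset val WU -> val G \subset val WV ->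
  less (back hU s) (back hV t) (val W) (val G) = less s t (lift (val W)) (lift (val G)).
Proof.
move=> sWG sGU sGV.
have sU := lift_subl sGU; have sV := lift_subr sGV.
have h := join_splits J G; have hW := join_splits J W.
have sWGm : val (join_face J W) \subset val (join_face J G).
  by apply: setUS (imsetS _ sWG).
have h3U := residue_splits sU.
have h3V := residue_splits sV.
have h23U := h3U; rewrite -(splits_assoc _ h hU sU) in h23U.
have h23V := h3V; rewrite -(splits_assoc _ h hV sV) in h23V.
have hWG := residue_splits sWG.
have hWGm := hWG; rewrite (splits_assoc _ hW h sWGm) in hWGm.
rewrite (lessE _ _ G hWG sGU sGV) // (lessE s t (join_face J G) hWGm sU sV) //.
rewrite (lam_back hU h3U h h23U sGU sU) (lam_back hV h3V h h23V sGV sV).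
by rewrite !(back_back h hWGm hW hWG).
Qed.

End Link.
End Compare.
Arguments agreeE {X m k k' U V} s t {l} F sU sV {W} _.
Arguments lessE {X m k k' U V} s t {l j F1} F2 {H} h sU sV {W G} _ _.

Lemma gap_psi m l (F : face m l) (Z : {set 'I_m}) :
  [disjoint val F & Z] -> gap F @: psi l (val F) Z = Z.
Proof.
move=> d; apply/setP => u; apply/imsetP/idP => [[j + ->]|uZ].
  by rewrite mem_psi.
have uF : u \notin val F by apply/negbT/(disjointFl d).
by have [j e] := gap_onto uF; exists j => //; rewrite mem_psi // -e.
Qed.

Section Link2.
Context (X : ordered_object).
Context (m l k k' : nat) (U : face m k) (V : face m k') (J : face m l).
Context (WU : face l k) (WV : face l k').
Context (hU : splits U J WU) (hV : splits V J WV).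
Context (s : bd X U) (t : bd X V).
Hypothesis est : agree s t (val J).

Lemma signed_good_back e (W Z : {set 'I_l}) :
    W :|: Z \subset val WU -> W :|: Z \subset val WV ->
  signed_good (back hU s) (back hV t) e W Z = signed_good s t e (val J :|: gap J @: W) (gap J @: Z).
Proof.
move=> sU sV; have sW : W \subset W :|: Z by apply: subsetUl.
rewrite /signed_good -setUA -imsetU !agree_back //; try exact: subset_trans sW _.
have L1 := @less_back_face _ _ _ _ _ _ _ _ _ _ hU hV s t _ _ (face_of W) (face_of (W :|: Z)) sW sU sV.
have L2 := @less_back_face _ _ _ _ _ _ _ _ _ _ hV hU t s _ _ (face_of W) (face_of (W :|: Z)) sW sV sU.
by case: e; rewrite ?L1 ?L2.
Qed.

End Link2.

Section Positive.
Context (X : ordered_object) (m : nat) (U V : {set 'I_m}).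
Context (s : bd X (face_of U)) (t : bd X (face_of V)).
Implicit Types P : disjoint_pair (U :&: V).

(** The middle component of mu_(V1, V2, V3) computed from the other bracketing: restrict to
    V1 :|: V2 first. *)
Lemma lam_circE (A : {set 'I_m}) (P : disjoint_pair A)
    (F := face_of (par P)) (W := face_of (psi (m - #|par P|) (par P) (circ P)))
    (G := join_face F W) (U' : {set 'I_m}) (sAU : A \subset U') (s' : bd X (face_of U'))
    (sG : val G \subset val (face_of U')) :
  lam_circ sAU P s' = back (join_splits F W) (lam sG s').
Proof.
have h3 := residue_splits sG.
have h13 := residue_splits (par_sub sAU P).
have h23 := h3; rewrite -(splits_assoc _ (join_splits F W) h13 sG) in h23.
rewrite /lam_circ /lam2 lam_rest_back.
exact: (lam_back _ h3 (join_splits F W) h23).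
Qed.

Lemma disjoint_pairP (A : {set 'I_m}) (P : disjoint_pair A) :
  [/\ par P \subset A, circ P \subset A & [disjoint par P & circ P]].
Proof. by case/and3P: (valP P) => *; split. Qed.

(** Goodness compares first pieces on W and middle pieces; as mu is injective, equality of
    both is equality of the restrictions to par P :|: circ P. *)
Lemma positiveE P :
  positive s t P = signed_good s t (odd (m + #|U| + #|V|)) (par P) (circ P).
Proof.
have [sP sC d] := disjoint_pairP P.
set F := face_of (par P); set W := face_of (psi (m - #|par P|) (par P) (circ P)).
set G := join_face F W.
have eG : val G = par P :|: circ P.
  have gp : gap F @: psi (m - #|par P|) (par P) (circ P) = circ P := gap_psi (F := F) d.
  by rewrite -[X in _ = _ :|: X]gp.
have sPC : par P :|: circ P \subset U :&: V by rewrite subUset sP.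
have sGU : val G \subset val (face_of U).
  by rewrite eG; apply: subset_trans sPC (subsetIl _ _).
have sGV : val G \subset val (face_of V).
  by rewrite eG; apply: subset_trans sPC (subsetIr _ _).
have h := join_splits F W.
rewrite /positive /good !(lam_circE _ _ sGU) !(lam_circE _ _ sGV).
rewrite -(agreeE s t F (par_sub (subsetIl U V) P) (par_sub (subsetIr U V) P) (erefl _)).
rewrite /signed_good -andbA; case: (boolP (agree _ _ _)) => //= aW; congr (_ && _).
  rewrite (agreeE s t G sGU sGV eG); congr (~~ _).
  apply/eqP/eqP => [e|->//].
  apply: (front_back_inj (sVU := splits_sub h) _ e).
  have sFU := par_sub (subsetIl U V) P; have sFV := par_sub (subsetIr U V) P.
  rewrite (lam_lam _ _ sFU) (lam_lam _ _ sFV).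
  by apply/eqP; rewrite -(agreeE s t F sFU sFV (erefl _)).
rewrite (lessE s t G (join_splits F W) sGU sGV) // (lessE t s G (join_splits F W) sGV sGU) //.
Qed.

End Positive.

(** * Counting chains of pairs of subsets modulo two *)

Lemma addrr2 (x : 'F_2) : x + x = 0.
Proof. by apply: addrr_pchar2; apply: pchar_Fp. Qed.

Lemma addr2_eq0 (x y : 'F_2) : x + y = 0 -> x = y.
Proof. by move=> e; rewrite -[y]add0r -e -addrA addrr2 addr0. Qed.

Lemma natr_addb (a b : bool) : (a (+) b)%:R = a%:R + b%:R :> 'F_2.
Proof. by case: a; case: b; rewrite ?addr0 ?add0r //= addrr2. Qed.

(** The unordered pairs of distinct elements each contribute twice. *)
Lemma symmetric_sum2 (T : finType) (Z : {set T}) (f : T -> T -> 'F_2) :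
  (forall v w, f v w = f w v) -> \sum_(w in Z) \sum_(v in Z :\ w) f w v = 0.
Proof.
move=> fC; pose r := @enum_rank T.
have split w : \sum_(v in Z :\ w) f w v =
    \sum_(v in Z | (r v < r w)%N) f w v + \sum_(v in Z | (r w < r v)%N) f w v.
  rewrite (bigID (fun v => (r v < r w)%N)) /=; congr (_ + _); apply: eq_bigl => v.
    rewrite !inE; case: (eqVneq v w) => [->|_]; rewrite ?ltnn ?andbF //.
  rewrite !inE -leqNgt leq_eqVlt eq_sym (inj_eq val_inj) (inj_eq enum_rank_inj).
  by case: (eqVneq v w) => [->|] /=; rewrite ?ltnn ?andbF.
rewrite (eq_bigr _ (fun w _ => split w)) big_split /=.
rewrite [X in _ + X](exchange_big_dep (mem Z)) /=; last by move=> ? ? _ /andP[].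
rewrite -big_split big1 //= => w wZ.
rewrite [X in _ + X](eq_bigl (fun v => (v \in Z) && (r v < r w)%N)); last first.
  by move=> v; rewrite wZ.
by rewrite [X in _ + X](eq_bigr (f w)) ?addrr2 // => v _; rewrite fC.
Qed.

Section ChainCount.
Context (T : finType).
Implicit Types (E : pred {set T}) (p : {set T} -> {set T} -> bool) (W Z : {set T}).

(** For p the good pairs of a sign, the number modulo 2 of chains of n pairs satisfying p
    and ending at (W, Z), where n = #|Z|.  The value [E W] for Z empty starts the recursion
    correctly: if (W, {z}) is good then E holds at W and fails at z |: W, so that the sum
    over the two candidates is 1, for the chain made of (W, {z}) alone. *)
Fixpoint chain_count_rec E p (n : nat) W Z : 'F_2 :=
  if n is n'.+1 then
    (p W Z)%:R * \sum_(w in Z) (chain_count_rec E p n' W (Z :\ w)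
                                + chain_count_rec E p n' (w |: W) (Z :\ w))
  else (E W)%:R.

Definition chain_count E p W Z : 'F_2 := chain_count_rec E p #|Z| W Z.

(** The boundary operator applied to [chain_count] as a function of (W, Z); its iterate
    vanishes by [symmetric_sum2]. *)
Definition facet_sum E p W Z : 'F_2 :=
  \sum_(w in Z) (chain_count E p W (Z :\ w) + chain_count E p (w |: W) (Z :\ w)).

Lemma chain_count0 E p W : chain_count E p W set0 = (E W)%:R.
Proof. by rewrite /chain_count cards0. Qed.

Lemma chain_countE E p W Z :
  Z != set0 -> chain_count E p W Z = (p W Z)%:R * facet_sum E p W Z.
Proof.
rewrite -card_gt0 /chain_count /facet_sum; case eZ: #|Z| => [|n] //= _.
congr (_ * _); apply: eq_bigr => w wZ.
by rewrite /chain_count; move: eZ; rewrite (cardsD1 w) wZ add1n => -[->].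
Qed.

Lemma eq_chain_count E E' p p' W Z :
    (forall A : {set T}, A \subset W :|: Z -> E A = E' A) ->
    (forall A B : {set T}, A :|: B \subset W :|: Z -> p A B = p' A B) ->
  chain_count E p W Z = chain_count E' p' W Z.
Proof.
move: {2}#|Z| (erefl #|Z|) => n; elim: n W Z => [|n IHn] W Z eZ eE ep.
  by move/cards0_eq: eZ eE => -> eE; rewrite !chain_count0 eE // setU0.
have Z0 : Z != set0 by rewrite -card_gt0 eZ.
rewrite !chain_countE // ep //; congr (_ * _); apply: eq_bigr => w wZ.
have cZ : #|Z :\ w| = n by move: eZ; rewrite (cardsD1 w) wZ => -[].
have s1 : W :|: Z :\ w \subset W :|: Z by rewrite setUS // subD1set.
have s2 : w |: W :|: Z :\ w \subset W :|: Z.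
  by rewrite setUAC setD1K // setUC.
congr (_ + _); apply: IHn => // A.
- by move=> sA; apply: eE; apply: subset_trans s1.
- by move=> B sA; apply: ep; apply: subset_trans s1.
- by move=> sA; apply: eE; apply: subset_trans s2.
- by move=> B sA; apply: ep; apply: subset_trans s2.
Qed.

Section Boundary.
Context (E : pred {set T}) (D : {set T}).
Hypothesis E_sub : forall A B : {set T}, A \subset B -> E B -> E A.

Definition good_sign p := forall W Z,  W :|: Z \subset D -> p W Z -> E W && ~~ E (W :|: Z).

(** If (W, Z) is not good then neither are the pairs below it, since E is closed under
    taking subsets; when Z is a singleton, E takes the same value at the two candidates. *)
Lemma facet_sum_bad p W Z : good_sign p -> W :|: Z \subset D ->
  Z != set0 -> ~~ (E W && ~~ E (W :|: Z)) -> facet_sum E p W Z = 0.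
Proof.
move=> gp sD Z0 bad.
have bad' w W' : w \in Z -> W \subset W' -> W' :|: Z :\ w \subset W :|: Z ->
    ~~ (E W' && ~~ E (W' :|: Z :\ w)).
  move=> wZ sW s; apply: contra bad => /andP[/(E_sub sW)-> /=].
  by apply: contra => /(E_sub s).
have [/eqP/cards1P[z eZ]|Z1] := eqVneq #|Z| 1%N.
  rewrite /facet_sum eZ big_set1 setDv !chain_count0.
  move: bad; rewrite eZ setUC; have := @E_sub W (z |: W) (subsetUr _ _).
  case: (E W) => /=; first by move=> _; rewrite negbK => ->; rewrite addrr2.
  by case: (E _) => [/(_ isT)//|_ _]; rewrite addr0.
rewrite /facet_sum big1 // => w wZ.
have Zw : Z :\ w != set0.
  by apply: contra Z1 => /eqP e; rewrite (cardsD1 w) wZ e cards0.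
have s1 : W :|: Z :\ w \subset W :|: Z by rewrite setUS // subD1set.
have s2 : w |: W :|: Z :\ w \subset W :|: Z.
  by rewrite setUAC setD1K // setUC.
rewrite !chain_countE //.
have -> : p W (Z :\ w) = false.
  apply/negbTE; apply: contra (bad' w W wZ (subxx _) s1); apply: gp.
  exact: subset_trans s1 sD.
have -> : p (w |: W) (Z :\ w) = false.
  apply/negbTE; apply: contra (bad' w (w |: W) wZ (subsetUr _ _) s2); apply: gp.
  exact: subset_trans s2 sD.
by rewrite !mul0r addr0.
Qed.

Context (p q : {set T} -> {set T} -> bool).
Hypothesis pq : forall W Z, W :|: Z \subset D ->
  p W Z (+) q W Z = E W && ~~ E (W :|: Z).
Hypothesis gp : good_sign p.
Hypothesis gq : good_sign q.

(** By induction on #|Z|, the sum of the two sides is the boundary of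
    chain_count p + chain_count q, which is the boundary of [facet_sum E q]: an iterated
    boundary. *)
Lemma facet_sumC W Z : W :|: Z \subset D -> facet_sum E p W Z = facet_sum E q W Z.
Proof.
move: {2}#|Z| (erefl #|Z|) => n; elim: n W Z => [|n IHn] W Z eZ sD.
  by move/cards0_eq: eZ => ->; rewrite /facet_sum !big_set0.
have s1 w : W :|: Z :\ w \subset W :|: Z by rewrite setUS // subD1set.
have s2 w : w \in Z -> w |: W :|: Z :\ w \subset W :|: Z.
  by move=> wZ; rewrite setUAC setD1K // setUC.
have cZ w : w \in Z -> #|Z :\ w| = n by move=> wZ; move: eZ; rewrite (cardsD1 w) wZ => -[].
have [/eqP/cards1P[z ->]|Z1] := eqVneq #|Z| 1%N.
  by rewrite /facet_sum big_set1 big_set1 setDv !chain_count0.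
have Zw w : w \in Z -> Z :\ w != set0.
  by move=> wZ; apply: contra Z1 => /eqP e; rewrite (cardsD1 w) wZ e cards0.
have key A B : B != set0 -> #|B| = n -> A :|: B \subset D ->
    chain_count E p A B + chain_count E q A B = facet_sum E q A B.
  move=> B0 cB sAB; rewrite !chain_countE // IHn // -mulrDl -natr_addb pq //.
  case: (boolP (E A && _)) => [_|bad]; first by rewrite mul1r.
  by rewrite mul0r (facet_sum_bad gq).
apply: addr2_eq0; rewrite {1 2}/facet_sum -big_split /=.
rewrite (eq_bigr (fun w => \sum_(v in Z :\ w)
   (chain_count E q W (Z :\ w :\ v) + chain_count E q (v |: W) (Z :\ w :\ v)
    + (chain_count E q (w |: W) (Z :\ w :\ v)
    + chain_count E q (v |: (w |: W)) (Z :\ w :\ v))))).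
  apply: symmetric_sum2 => v w.
  rewrite (_ : Z :\ v :\ w = Z :\ w :\ v); last by rewrite !setDDl setUC.
  by rewrite setUCA -!addrA; congr (_ + _); rewrite addrCA.
move=> w wZ; rewrite addrACA.
rewrite key ?cZ ?Zw //; last exact: subset_trans (s1 _) sD.
rewrite key ?cZ ?Zw //; last exact: subset_trans (s2 _ wZ) sD.
by rewrite /facet_sum -big_split.
Qed.

(** Both counts have the same factor [facet_sum], by [facet_sumC], and a good pair has
    exactly one sign. *)
Lemma chain_count_boundary W Z : W :|: Z \subset D -> Z != set0 ->
  chain_count E p W Z + chain_count E q W Z = facet_sum E q W Z.
Proof.
move=> sD Z0; rewrite !chain_countE // facet_sumC // -mulrDl -natr_addb pq //.
case: (boolP (E W && _)) => [_|bad]; first by rewrite mul1r.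
by rewrite mul0r (facet_sum_bad gq).
Qed.

End Boundary.
End ChainCount.

(** Pairs of subsets of T' are seen as pairs of subsets of T, J being added to the first
    member. *)
Section Transport.
Context (T T' : finType) (g : T' -> T) (J : {set T}).
Hypothesis g_inj : injective g.

Lemma chain_count_transport (E : pred {set T}) (E' : pred {set T'}) p p' W Z :
    (forall A : {set T'}, A \subset W :|: Z -> E' A = E (J :|: g @: A)) ->
    (forall A B : {set T'}, A :|: B \subset W :|: Z -> p' A B = p (J :|: g @: A) (g @: B)) ->
  chain_count E' p' W Z = chain_count E p (J :|: g @: W) (g @: Z).
Proof.
move: {2}#|Z| (erefl #|Z|) => n; elim: n W Z => [|n IHn] W Z eZ eE ep.
  by move/cards0_eq: eZ eE => -> eE; rewrite imset0 !chain_count0 eE // setU0.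
have Z0 : Z != set0 by rewrite -card_gt0 eZ.
have gZ0 : g @: Z != set0 by rewrite -card_gt0 card_imset // eZ.
rewrite !chain_countE // ep //; congr (_ * _).
rewrite /facet_sum big_imset /=; last by move=> ? ? _ _; apply: g_inj.
apply: eq_bigr => w wZ.
have cZ : #|Z :\ w| = n by move: eZ; rewrite (cardsD1 w) wZ => -[].
have gD : g @: Z :\ g w = g @: (Z :\ w).
  apply/setP => u; rewrite !inE; apply/andP/imsetP => [[ug /imsetP[v vZ uv]]|[v]].
    by exists v; rewrite // !inE vZ andbT; apply: contra ug => /eqP <-; rewrite uv.
  by rewrite !inE => /andP[vw vZ] ->; rewrite inj_eq // vw imset_f.
have s1 : W :|: Z :\ w \subset W :|: Z by rewrite setUS // subD1set.
have s2 : w |: W :|: Z :\ w \subset W :|: Z.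
  by rewrite setUAC setD1K // setUC.
rewrite gD (setUCA [set g w]) -imset_set1 -imsetU.
congr (_ + _); apply: IHn => // A.
- by move=> sA; apply: eE; apply: subset_trans s1.
- by move=> B sA; apply: ep; apply: subset_trans s1.
- by move=> sA; apply: eE; apply: subset_trans s2.
- by move=> B sA; apply: ep; apply: subset_trans s2.
Qed.

End Transport.

(** * Chains of good pairs are counted by the recursion *)

Lemma sum_tuple_cons (T : finType) n (F : n.+1.-tuple T -> 'F_2) :
  \sum_c F c = \sum_x \sum_(c : n.-tuple T) F [tuple of x :: c].
Proof.
rewrite pair_big /=.
rewrite (reindex (fun xc : T * n.-tuple T => [tuple of xc.1 :: xc.2])) //=.
exists (fun c : n.+1.-tuple T => (thead c, [tuple of behead c])) => [[x c] _|c _] /=.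
  by congr (_, _); apply: val_inj.
by rewrite -tuple_eta.
Qed.

Section PathCount.
Context (T : finType) (e : rel T) (p : pred T).

(** Sequences of n elements preceding y in an e-sorted sequence of elements of p, listed
    from the nearest to y, so that removing the nearest one is removing the head. *)
Definition path_count n (y : T) : 'F_2 :=
  \sum_(c : n.-tuple T) ([&& path (fun a b => e b a) y c, p y & all p c])%:R.

Lemma path_count0 y : path_count 0 y = (p y)%:R.
Proof.
rewrite /path_count (big_pred1 [tuple]) /= ?andbT // => c.
exact/esym/eqP/tuple0.
Qed.

Lemma path_countS n y :
  path_count n.+1 y = (p y)%:R * \sum_(x | e x y) path_count n x.
Proof.
rewrite /path_count sum_tuple_cons mulr_sumr [RHS]big_mkcond /=.
apply: eq_bigr => x _; case: (e x y) => /=; last by rewrite big1.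
rewrite mulr_sumr; apply: eq_bigr => c _.
by case: (p y); rewrite ?mul1r ?mul0r //= andbF.
Qed.

Lemma card_sorted_tuples n :
  #|[set c : n.+1.-tuple T | sorted e c && all p c]|%:R = \sum_y path_count n y.
Proof.
rewrite -sum1_card natr_sum big_mkcond /=.
rewrite (reindex (fun c : n.+1.-tuple T => [tuple of rev c])) /=; last first.
  by exists (fun c : n.+1.-tuple T => [tuple of rev c]) => c _; apply: val_inj;
    rewrite /= revK.
rewrite sum_tuple_cons; apply: eq_bigr => x _; apply: eq_bigr => c _.
by rewrite inE rev_sorted all_rev /=; case: ifP.
Qed.

End PathCount.

Section PairChains.
Context (m : nat) (C : {set 'I_m}) (E : pred {set 'I_m}).
Context (q : {set 'I_m} -> {set 'I_m} -> bool) (p : pred (disjoint_pair C)).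
Hypothesis pq : forall P, p P = q (par P) (circ P).
Hypothesis q_good : forall W Z : {set 'I_m}, q W Z -> E W && ~~ E (W :|: Z).

Let count := path_count (@prec m C) p.

Lemma precP (P0 P1 : disjoint_pair C) :
  reflect (exists2 w, w \in circ P1 & circ P0 = circ P1 :\ w /\ par P1 = par P0 :\ w)
          (prec P0 P1).
Proof.
apply: (iffP existsP) => -[w].
  case/and3P => wP0 /eqP e1 /eqP e2; exists w; first by rewrite e1 setU11.
  by rewrite e1 setU1K.
move=> wP1 [e1 e2]; exists w; rewrite e2 eqxx andbT e1 setD1K // eqxx andbT.
by rewrite setD11.
Qed.

(** A good pair has a nonempty circ part, and this part gains one element at each step of a
    chain: a chain of n + 1 good pairs cannot end at P if #|circ P| <= n. *)
Lemma path_count_short n P : (#|circ P| <= n)%N -> count n P = 0.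
Proof.
elim: n P => [|n IHn] P.
  rewrite leqn0 cards_eq0 => /eqP e0; rewrite /count path_count0 pq.
  by case: (boolP (q _ _)) => // /q_good; rewrite e0 setU0 andbN.
move=> cP; rewrite /count path_countS big1 ?mulr0 // => P0 /precP[w wP [e1 _]].
by apply: IHn; rewrite e1 -ltnS; move: cP; rewrite (cardsD1 w) wP.
Qed.

Lemma pair_subproof (P : disjoint_pair C) (w : 'I_m) :
    w \in circ P ->
  [&& par P \subset C, circ P :\ w \subset C & [disjoint par P & circ P :\ w]] &&
  [&& w |: par P \subset C, circ P :\ w \subset C & [disjoint w |: par P & circ P :\ w]].
Proof.
case/and3P: (valP P); rewrite -/(par P) -/(circ P) => s1 s2 d wP.
rewrite s1 (subset_trans (subD1set _ _) s2) subUset sub1set (subsetP s2 _ wP) s1 /=.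
have d1 : [disjoint par P & circ P :\ w].
  by rewrite disjoint_sym; apply: disjointWl (subD1set _ _) _; rewrite disjoint_sym.
by rewrite d1 -setI_eq0 setIUl setU_eq0 !setI_eq0 d1 andbT disjoints1 setD11.
Qed.

(** The predecessors of P = (W, Z) are the (W, Z :\ w) and (w |: W, Z :\ w) for w in Z, and w
    is determined by the predecessor: the two recursions agree. *)
Lemma path_count_chain n P : #|circ P| = n.+1 ->
  count n P = chain_count E q (par P) (circ P).
Proof.
elim: n P => [|n IHn] P cP.
  have /cards1P[z eZ] : #|circ P| == 1%N by rewrite cP.
  rewrite chain_countE -?card_gt0 ?cP // /facet_sum eZ big_set1 setDv.
  rewrite !chain_count0 /count path_count0 pq eZ.
  case: (boolP (q _ _)) => [/q_good/andP[-> nE]|_]; last by rewrite mul0r.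
  by rewrite mul1r setUC (negbTE nE) addr0.
rewrite chain_countE -?card_gt0 ?cP // /count path_countS pq; congr (_ * _).
pose step w (P0 : disjoint_pair C) := (circ P0 == circ P :\ w) && (par P == par P0 :\ w).
transitivity (\sum_(w in circ P) \sum_(P0 | step w P0) count n P0).
  rewrite [RHS](exchange_big_dep xpredT) //= [LHS]big_mkcond -/count; apply: eq_bigr => P0 _.
  case: precP => [[w wP [e1 e2]]|nP]; last first.
    by rewrite big_pred0 // => w; apply/negP => /and3P[wP /eqP e1 /eqP e2]; case: nP; exists w.
  rewrite (big_pred1 w) // => w'; apply/and3P/eqP => [[wP' /eqP e1' _]|->]; last first.
    by rewrite wP -e1 -e2.
  apply/eqP; have : w' \notin circ P :\ w by rewrite -e1 e1' setD11.
  by rewrite !inE wP' andbT negbK.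
apply: eq_bigr => w wP.
have /andP[pf1 pf2] := pair_subproof wP.
pose P1 : disjoint_pair C := exist _ (par P, circ P :\ w) pf1.
pose P2 : disjoint_pair C := exist _ (w |: par P, circ P :\ w) pf2.
have c1 : #|circ P1| = n.+1.
  by move: cP; rewrite (cardsD1 w) wP add1n => -[<-].
have [_ _ d] := disjoint_pairP P.
have wN : w \notin par P by rewrite (disjointFl d wP).
rewrite (bigD1 P1) /=; last first.
  by rewrite /step eqxx /=; apply/eqP/setP => u; rewrite !inE; case: eqP => // ->; exact/negbTE.
rewrite (big_pred1 P2) ?IHn // => P0; rewrite /step.
apply/andP/eqP => [[/andP[/eqP e1 /eqP e2] n1]|->]; last first.
  rewrite eqxx /= setU1K // eqxx; split=> //.
  by apply/eqP => /(congr1 (fun P => w \in par P)); rewrite /= (negbTE wN) setU11.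
apply: val_inj; rewrite [LHS]surjective_pairing /=; congr (_, _) => //.
have wP0 : w \in par P0.
  apply/negPn/negP => wP0; move/eqP: n1; apply.
  apply: val_inj; rewrite [LHS]surjective_pairing /=; congr (_, _) => //.
  by rewrite e2; apply/setP => u; rewrite !inE; case: eqP => // ->; exact/negbTE.
by rewrite e2 setD1K.
Qed.

(** A chain of length #|C| ends at (set0, C), by [path_count_short]; the hypothesis accounts
    for the empty chain. *)
Lemma card_pair_chains : E set0 ->
  #|[set c : #|C|.-tuple _ | sorted (@prec m C) c && all p c]|%:R = chain_count E q set0 C.
Proof.
move=> E0; case cC: #|C| => [|n].
  have C0 : C = set0 by apply: cards0_eq.
  rewrite [in RHS]C0 chain_count0 E0 (_ : [set c | _] = [set [tuple]]) ?cards1 //.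
  by apply/setP => c; rewrite !inE tuple0 eqxx.
rewrite card_sorted_tuples.
have pf : [&& (set0 : {set 'I_m}) \subset C, C \subset C & [disjoint set0 & C]].
  by rewrite sub0set subxx -setI_eq0 set0I eqxx.
pose P1 : disjoint_pair C := exist _ (set0, C) pf.
rewrite (bigD1 P1) //= big1 ?addr0 => [|P nP].
  by apply: path_count_chain.
apply: path_count_short; rewrite -ltnS -cC; apply: proper_card.
have [sP sC d] := disjoint_pairP P; rewrite properEneq sC andbT.
apply: contra nP => /eqP eC; apply/eqP/val_inj.
rewrite [LHS]surjective_pairing /=; congr (_, _) => //.
by have := disjoint_setI0 d; rewrite eC => /= e; rewrite -[LHS](setIidPl sP).
Qed.

End PairChains.

Section Count.
Context (X : ordered_object) (m : nat) (U V : {set 'I_m}).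
Context (s : bd X (face_of U)) (t : bd X (face_of V)).

Lemma agree_sub k k' (U' : face m k) (V' : face m k') (s' : bd X U') (t' : bd X V')
    (A B : {set 'I_m}) :
  A \subset B -> agree s' t' B -> agree s' t' A.
Proof.
move=> sAB aB; have sU := agree_subl aB; have sV := agree_subr aB.
pose F := face_of A; pose G := face_of B.
have sFG : val F \subset val G := sAB.
have sGU : val G \subset val U' := sU.
have sGV : val G \subset val V' := sV.
have sFU := subset_trans sFG sGU; have sFV := subset_trans sFG sGV.
move: aB; rewrite (agreeE s' t' G sGU sGV) // (agreeE s' t' F sFU sFV) // => /eqP e.
by rewrite -(lam_lam sGU sFG sFU) -(lam_lam sGV sFG sFV) e.
Qed.

Lemma signed_good_good k k' (U' : face m k) (V' : face m k') (s' : bd X U') (t' : bd X V')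
    e (W Z : {set 'I_m}) :
  signed_good s' t' e W Z -> agree s' t' W && ~~ agree s' t' (W :|: Z).
Proof. by case/and3P=> -> ->. Qed.

(** d_set0 is an identity span, whose elements are determined by their source. *)
Lemma agree0 k k' (U' : face m k) (V' : face m k') (s' : bd X U') (t' : bd X V') :
  source s' = source t' -> agree s' t' set0.
Proof.
move=> e; rewrite (agreeE s' t' (empty_face m) (sub0set _) (sub0set _)) //.
have [b _] := bd_empty X m; apply/eqP/(bij_inj b).
by rewrite !lam_source.
Qed.

Lemma card_positive_chains : source s = source t ->
  #|positive_chains s t|%:R =
  chain_count (agree s t) (signed_good s t (odd (m + #|U| + #|V|))) set0 (U :&: V).
Proof.
move=> e.
rewrite -(@card_pair_chains _ _ _ _ (positive s t) (positiveE s t)) ?agree0 //; last first.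
  exact: signed_good_good.
congr (_%:R); apply: eq_card => c; rewrite !inE -andbA; congr (_ && _).
apply/andP/idP => [[]//|a]; split=> //; apply/allP => P /(allP a).
by rewrite /positive => /andP[].
Qed.

End Count.

(** * Sequences with repetitions as pairs of subsets *)

Section Admissible.
Context (m : nat).
Implicit Types (A B D : {set 'I_m}) (U : seq 'I_m) (u v : 'I_m).

Definition rank_in D u : nat := #|[set v in D | (v < u)%N]|.

(** A pair (A, B) is (U^-, U^+) for a sequence U iff, among the entries which lie in only one
    of A and B, those of A are the ones of odd index.  The repeated entries are those of
    A :&: B, so that U is recovered from (A, B). *)
Definition admissible A B : bool :=
  [forall u, (u \in A) (+) (u \in B) ==>
             ((u \in A) == odd (u + (rank_in (A :|: B) u).+1))].

Lemma index_sorted_ltn U u :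
  sorted ltn [seq val v | v <- U] -> u \in U ->
  index u U = count (fun v : 'I_m => (v < u)%N) U.
Proof.
elim: U => //= x U IHU; rewrite path_map => pU; rewrite inE eq_sym.
have lt_x v : v \in U -> (x < v)%N.
  have : all (fun w : 'I_m => (x < w)%N) U.
    by apply: (order_path_min _ pU) => a b c; apply: ltn_trans.
  by move/allP; apply.
have sU : sorted ltn [seq val v | v <- U].
  by rewrite sorted_map; apply: path_sorted pU.
case: eqP => [<- _|_ /= uU].
  rewrite ltnn; apply/esym/eqP; rewrite -leqn0 leqNgt -has_count.
  by apply/hasPn => v /lt_x; rewrite -leqNgt; apply: ltnW.
by rewrite lt_x // IHU.
Qed.

Section Sequence.
Context (U : seq 'I_m).
Hypothesis twU : at_most_twice U.

Lemma undup_sorted : sorted ltn [seq val u | u <- undup U].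
Proof.
have /andP[sU _] := twU.
rewrite ltn_sorted_uniq_leq map_inj_uniq ?undup_uniq /=; last exact: val_inj.
rewrite !sorted_map in sU *.
by apply: subseq_sorted (undup_subseq U) sU => a b c; apply: leq_trans.
Qed.

Lemma entry_indexE u D : u \in U -> U =i D ->
  entry_index U u = (u + (rank_in D u).+1)%N.
Proof.
move=> uU UD; rewrite /entry_index index_sorted_ltn ?undup_sorted ?mem_undup //.
congr (_ + _.+1)%N; rewrite -size_filter /rank_in cardE; apply: perm_size.
apply: uniq_perm => [||v]; [exact/filter_uniq/undup_uniq|exact: enum_uniq|].
by rewrite mem_filter mem_undup mem_enum !inE UD andbC.
Qed.

Lemma count_parts u :
  count_mem u U = ((u \in minus_part U) + (u \in plus_part U))%N.
Proof.
have /andP[_ /forallP/(_ u) le2] := twU.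
rewrite !inE /repeated; case: (boolP (u \in U)) => [uU|/count_memPn->] //=.
have : (0 < count_mem u U)%N by rewrite -has_count has_pred1.
by move: (count_mem u U) le2 => [|[|[|]]] //=; case: (odd _).
Qed.

Lemma mem_parts : U =i minus_part U :|: plus_part U.
Proof.
by move=> u; rewrite -has_pred1 has_count count_parts in_setU; do 2![case: (u \in _)].
Qed.

Lemma parts_admissible : admissible (minus_part U) (plus_part U).
Proof.
apply/forallP => u; apply/implyP => ne.
have uU : u \in U by rewrite mem_parts in_setU; move: ne; do 2![case: (u \in _)].
rewrite -(entry_indexE uU mem_parts); move: ne; rewrite !inE uU /=.
by case: (repeated U u) => //=; rewrite eqxx.
Qed.

(** This makes U, being sorted, determined by its two parts. *)
Lemma parts_perm : perm_eq U (enum (minus_part U) ++ enum (plus_part U)).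
Proof.
apply/allP => u _; apply/eqP => /=.
by rewrite count_parts count_cat !(count_uniq_mem _ (enum_uniq _)) !mem_enum.
Qed.

End Sequence.

Lemma sort_twice A B :
  at_most_twice (sort (fun u v : 'I_m => (u <= v)%N) (enum A ++ enum B)).
Proof.
apply/andP; split.
  by rewrite sorted_map; apply: sort_sorted => a b; apply: leq_total.
apply/forallP => u; rewrite count_sort count_cat !(count_uniq_mem _ (enum_uniq _)).
by do 2![case: (u \in _)].
Qed.

Lemma parts_sort A B : admissible A B ->
  let U := sort (fun u v : 'I_m => (u <= v)%N) (enum A ++ enum B) in
  minus_part U = A /\ plus_part U = B.
Proof.
move=> adm U; have twU : at_most_twice U by apply: sort_twice.
have memU : U =i A :|: B.
  by move=> u; rewrite mem_sort mem_cat !mem_enum inE.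
have repU u : repeated U u = (u \in A) && (u \in B).
  rewrite /repeated count_sort count_cat !(count_uniq_mem _ (enum_uniq _)) !mem_enum.
  by do 2![case: (u \in _)].
have oddU u : u \in U -> ~~ repeated U u -> odd (entry_index U u) = (u \in A).
  move=> uU; rewrite repU => nu; rewrite (entry_indexE twU uU memU).
  move/forallP: adm => /(_ u) /implyP h; apply/esym/eqP; apply: h.
  by move: uU nu; rewrite memU inE; do 2![case: (u \in _)].
split; apply/setP => u; rewrite inE.
  case: (boolP (u \in U)) => [uU|]; last by rewrite memU inE => /norP[/negbTE->].
  case: (boolP (repeated U u)) => [|n]; first by rewrite repU => /andP[->].
  by rewrite oddU.
case: (boolP (u \in U)) => [uU|]; last by rewrite memU inE => /norP[_ /negbTE->].
case: (boolP (repeated U u)) => [|n]; first by rewrite repU => /andP[_ ->].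
rewrite oddU //=; move: uU n; rewrite memU inE repU.
by do 2![case: (u \in _)].
Qed.

Lemma sum_at_most_twice q (F : {set 'I_m} -> {set 'I_m} -> 'F_2) :
  \sum_(U : q.-tuple 'I_m | at_most_twice U) F (minus_part U) (plus_part U) =
  \sum_(AB : {set 'I_m} * {set 'I_m} |
          (#|AB.1| + #|AB.2| == q)%N && admissible AB.1 AB.2) F AB.1 AB.2.
Proof.
pose h (U : q.-tuple 'I_m) := (minus_part U, plus_part U).
pose S := [set U : q.-tuple 'I_m | at_most_twice U].
transitivity (\sum_(U in S) F (h U).1 (h U).2).
  by apply: eq_bigl => U; rewrite inE.
have hinj : {in S &, injective h}.
  move=> U U'; rewrite !inE => tU tU' [e1 e2]; apply: val_inj.
  have p : perm_eq U U'.
    by rewrite (perm_trans (parts_perm tU)) // e1 e2 perm_sym parts_perm.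
  apply: (inj_map val_inj).
  case/andP: tU tU' => sU _ /andP[sU' _].
  apply: (sorted_eq _ _ sU sU'); [exact: leq_trans|exact: anti_leq|exact: perm_map].
rewrite -(big_imset (fun AB => F AB.1 AB.2) hinj) /=; apply: eq_bigl => -[A B].
apply/imsetP/andP => /= [[U + [-> ->]]|[/eqP sz adm]].
  rewrite inE => tU; split; last exact: parts_admissible.
  by rewrite !cardE -size_cat -(perm_size (parts_perm tU)) size_tuple.
have [e1 e2] := parts_sort adm.
have szU : size (sort (fun u v : 'I_m => (u <= v)%N) (enum A ++ enum B)) == q.
  by rewrite size_sort size_cat -!cardE sz.
exists (Tuple szU); first by rewrite inE; apply: sort_twice.
by rewrite /h /= e1 e2.
Qed.

End Admissible.

(** * The coefficient identity *)

Lemma rank_in_remove m (D : {set 'I_m}) (a u : 'I_m) : a \in D ->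
  rank_in D u = ((a < u) + rank_in (D :\ a) u)%N.
Proof.
move=> aD; rewrite /rank_in (cardsD1 a) !inE aD /=; congr (_ + _)%N.
by apply: eq_card => v; rewrite !inE andbA.
Qed.

(** The effect on admissibility of removing one element from A or from B.  Below, [single]
    is the set of non-repeated entries, [bad u] says that u is on the wrong side for its
    index, and [switch a] that the entries before a are on the right side and those after a
    on the wrong one. *)
Section Removal.
Context (m : nat) (A B : {set 'I_m}).
Implicit Types (u v a c : 'I_m).

Let idx u := odd (u + (rank_in (A :|: B) u).+1).
Let single u := (u \in A) (+) (u \in B).
Let bad u := (u \in A) != idx u.
Let switch a := [forall u, (single u && (u != a)) ==> (bad u == (a < u)%N)].

Lemma admissibleE : admissible A B = [forall u, single u ==> ~~ bad u].
Proof. by apply: eq_forallb => u; rewrite /bad negbK. Qed.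

Lemma admissibleCE : admissible B A = [forall u, single u ==> bad u].
Proof.
apply: eq_forallb => u; rewrite addbC -/(single u) setUC -/(idx u) /bad /single.
by do 2![case: (u \in _)]; case: (idx u).
Qed.

(** Removing a non-repeated entry lowers the index of each later one by 1. *)
Lemma admissible_remove_singleL a : a \in A -> a \notin B ->
  admissible (A :\ a) B = switch a.
Proof.
move=> aA aB; apply: eq_forallb => u; rewrite /single !inE.
have [->|ua] := eqVneq u a; first by rewrite (negbTE aB) !andbF.
rewrite andbT /=; case: (_ (+) _) => //=.
have -> : A :\ a :|: B = (A :|: B) :\ a.
  by apply/setP => v; rewrite !inE; case: eqP => // ->; rewrite (negbTE aB).
rewrite /bad /idx (rank_in_remove u (_ : a \in A :|: B)) ?inE ?aA //.
rewrite -addnS addnCA [odd (_ + (u + _))]oddD oddb; set o := odd _.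
by case: (u \in A); case: o; case: (a < u)%N.
Qed.

Lemma admissible_remove_singleR a : a \in B -> a \notin A ->
  admissible A (B :\ a) = switch a.
Proof.
move=> aB aA; apply: eq_forallb => u; rewrite /single !inE.
have [->|ua] := eqVneq u a; first by rewrite (negbTE aA) andbF.
rewrite andbT /=; case: (_ (+) _) => //=.
have -> : A :|: B :\ a = (A :|: B) :\ a.
  by apply/setP => v; rewrite !inE; case: eqP => // ->; rewrite (negbTE aA).
rewrite /bad /idx (rank_in_remove u (_ : a \in A :|: B)) ?inE ?aB ?orbT //.
rewrite -addnS addnCA [odd (_ + (u + _))]oddD oddb; set o := odd _.
by case: (u \in A); case: o; case: (a < u)%N.
Qed.

(** The indices are unchanged, and c becomes a non-repeated entry of the other set. *)
Lemma admissible_remove_doubleL c : c \in A -> c \in B ->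
  admissible (A :\ c) B = admissible A B && ~~ idx c.
Proof.
move=> cA cB; have eD : A :\ c :|: B = A :|: B.
  by apply/setP => v; rewrite !inE; case: eqP => // ->; rewrite cB !orbT.
apply/forallP/andP => [h|[/forallP h nc] u].
  split; last by have := h c; rewrite !inE eqxx cB eD eq_sym eqbF_neg.
  apply/forallP => u; have := h u; rewrite !inE eD.
  by have [->|//] := eqVneq u c; rewrite cA cB.
have := h u; rewrite !inE eD; have [->|//] := eqVneq u c => _.
by rewrite cB /= eq_sym eqbF_neg.
Qed.

Lemma admissible_remove_doubleR c : c \in A -> c \in B ->
  admissible A (B :\ c) = admissible A B && idx c.
Proof.
move=> cA cB; have eD : A :|: B :\ c = A :|: B.
  by apply/setP => v; rewrite !inE; case: eqP => // ->; rewrite cA.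
apply/forallP/andP => [h|[/forallP h nc] u].
  split; last by have := h c; rewrite !inE eqxx cA eD eq_sym eqb_id.
  apply/forallP => u; have := h u; rewrite !inE eD.
  by have [->|//] := eqVneq u c; rewrite cA cB.
have := h u; rewrite !inE eD; have [->|//] := eqVneq u c => _.
by rewrite cA /= eq_sym eqb_id.
Qed.

(** Let T k say that the wrongly placed entries are exactly those with v >= k.  For an entry
    k, exactly one of T k and T k.+1 holds if [switch k], and none otherwise; for other k they
    coincide.  The sum telescopes to T 0 + T m, i.e. all entries wrong or all right. *)
Lemma sum_switch :
  \sum_(a | single a) (switch a)%:R =
  (admissible A B)%:R + (admissible B A)%:R :> 'F_2.
Proof.
pose T k : 'F_2 := ([forall v, single v ==> (bad v == (k <= v)%N)])%:R.
have -> : (admissible A B)%:R = T m.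
  congr (_%:R); rewrite admissibleE; congr (nat_of_bool _); apply: eq_forallb => v.
  by rewrite leqNgt ltn_ord eqbF_neg.
have -> : (admissible B A)%:R = T 0%N.
  congr (_%:R); rewrite admissibleCE; congr (nat_of_bool _); apply: eq_forallb => v.
  by rewrite eqb_id.
have tele : T m + T 0%N = \sum_(k < m) (T k.+1 + T k).
  elim: m => [|n IHn]; first by rewrite big_ord0 addrr2.
  by rewrite big_ord_recr /= -IHn addrCA addrAC addrr2 add0r addrC.
rewrite tele big_mkcond; apply: eq_bigr => a _; rewrite /T.
case: ifP => sa; last first.
  suff -> : [forall v, single v ==> (bad v == (a < v)%N)] =
            [forall v, single v ==> (bad v == (a <= v)%N)] by rewrite addrr2.
  apply: eq_forallb => v; case: (boolP (single v)) => //= sv.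
  have av : a != v by apply: contraTneq sv => <-; rewrite sa.
  by rewrite [in RHS]leq_eqVlt (inj_eq val_inj) (negbTE av).
rewrite -natr_addb; congr (nat_of_bool _)%:R.
have eT k : (forall v, v != a -> (k <= v)%N = (a < v)%N) ->
  [forall v, single v ==> (bad v == (k <= v)%N)] = switch a && (bad a == (k <= a)%N).
  move=> ek; apply/forallP/andP => [h|[/forallP h ha] v].
    split; last by have := h a; rewrite sa.
    by apply/forallP => v; apply/implyP => /andP[sv va]; have := h v; rewrite sv ek.
  apply/implyP => sv; have [->//|va] := eqVneq v a.
  by have := h v; rewrite sv va ek.
rewrite (eT a.+1) // (eT a); last first.
  by move=> v va; rewrite leq_eqVlt eq_sym (inj_eq val_inj) (negbTE va).
by rewrite ltnn leqnn; case: (switch a); case: (bad a).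
Qed.

Section Coefficient.
Context (c : {set 'I_m} -> {set 'I_m} -> 'F_2) (c' : 'F_2).
Let C := A :&: B.
Hypothesis cc' : c' + c set0 C = \sum_(j in C) (c set0 (C :\ j) + c [set j] (C :\ j)).

(** Here c W Z stands for the count with the sign opposite to that of (A, B), and c' for the
    count of positive chains.  The left-hand side collects the contributions to the
    coefficient of target(s) (x) target(t) of the boundary on the first factor, on the second
    factor, and on the simplex itself; the right-hand side those of the two products of
    degree i - 1.  Non-repeated entries contribute through [sum_switch]; the repeated ones are
    each counted once, on the side chosen by their index, and are matched by the
    hypothesis. *)
Lemma coefficient_identity :
    \sum_(a in A | admissible (A :\ a) B) c set0 ((A :\ a) :&: B)
  + \sum_(b in B | admissible A (B :\ b)) c set0 (A :&: (B :\ b))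
  + (admissible A B)%:R * \sum_(j in C) c [set j] (C :\ j)
  = (admissible A B)%:R * c' + (admissible B A)%:R * c set0 C.
Proof.
rewrite (bigID (mem B)) [X in _ + X + _](bigID (mem A)) /=.
set SA := (X in X + _ + (_ + _) + _); set SA' := (X in _ + X + (_ + _) + _).
set SB := (X in _ + (X + _) + _); set SB' := (X in _ + (_ + X) + _).
have eS : SA' + SB' = ((admissible A B)%:R + (admissible B A)%:R) * c set0 C.
  rewrite -sum_switch mulr_suml (bigID (mem A)) /=; congr (_ + _).
    rewrite /SA' big_mkcond [RHS]big_mkcond; apply: eq_bigr => a _ /=.
    rewrite /single; case: (boolP (a \in A)) => aA; rewrite ?andbF //=.
    case: (boolP (a \in B)) => aB; rewrite ?andbF //= andbT.
    rewrite admissible_remove_singleL //.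
    have -> : (A :\ a) :&: B = C.
      by apply/setP => v; rewrite !inE; case: eqP => // ->; rewrite (negbTE aB) !andbF.
    by case: (switch a); rewrite ?mul1r ?mul0r.
  rewrite /SB' big_mkcond [RHS]big_mkcond; apply: eq_bigr => a _ /=.
  rewrite /single; case: (boolP (a \in A)) => aA; rewrite ?andbF //=.
  case: (boolP (a \in B)) => aB; rewrite ?andbF //= andbT.
  rewrite admissible_remove_singleR //.
  have -> : A :&: (B :\ a) = C.
    by apply/setP => v; rewrite !inE; case: eqP => // ->; rewrite (negbTE aA).
  by case: (switch a); rewrite ?mul1r ?mul0r.
have eD : SA + SB = (admissible A B)%:R * \sum_(j in C) c set0 (C :\ j).
  rewrite /SA /SB mulr_sumr [X in X + _ = _]big_mkcond [X in _ + X = _]big_mkcond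
    [RHS]big_mkcond -big_split /=.
  apply: eq_bigr => j _; rewrite !inE.
  case: (boolP (j \in A)) => jA /=; last by rewrite !andbF addr0.
  case: (boolP (j \in B)) => jB; rewrite ?andbF ?addr0 //= !andbT.
  rewrite admissible_remove_doubleL // admissible_remove_doubleR //.
  have -> : (A :\ j) :&: B = C :\ j by apply/setP => v; rewrite !inE andbA.
  have -> : A :&: (B :\ j) = C :\ j by apply/setP => v; rewrite !inE andbCA.
  by case: (admissible A B); case: (idx j); rewrite /= ?mul1r ?mul0r ?addr0 ?add0r.
rewrite addrACA eS eD addrAC -mulrDr -big_split -cc' mulrDr mulrDl.
by rewrite addrA -[_ * c' + _ + _]addrA addrr2 addr0.
Qed.

End Coefficient.
End Removal.

(** * Sums over fibres of spans *)

Section FibreSums.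
Context (X Y : choiceType).
Implicit Types (Q : Defs.span X Y) (x : X).

Definition fibre_seq Q x : seq Q :=
  finmap.enum_fset (fset_set (fibre Q x)).

Lemma mem_fibre_seq Q x (e : Q) : (e \in fibre_seq Q x) = (source e == x).
Proof.
rewrite /fibre_seq in_fset_set; last exact: source_finite.
by apply/idP/eqP; rewrite in_setE.
Qed.

Lemma fibre_seq_uniq Q x : uniq (fibre_seq Q x).
Proof. exact: finmap.fset_uniq. Qed.

Lemma fibre_sumE (M : nmodType) Q x (F : Q -> M) :
  \sum_(e \in fibre Q x) F e = \sum_(e <- fibre_seq Q x) F e.
Proof. exact/fsbig_finite/source_finite. Qed.

Lemma sum_fibrewise_bijection (M : nmodType) (P Q : Defs.span X Y)
    (phi : fibrewise_bijection P Q) x (F : Q -> M) :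
  \sum_(e <- fibre_seq P x) F (phi e) = \sum_(e <- fibre_seq Q x) F e.
Proof.
rewrite -(big_map phi xpredT); apply: perm_big; apply: uniq_perm.
- by rewrite map_inj_uniq ?fibre_seq_uniq //; apply: bij_inj (fib_bij phi).
- exact: fibre_seq_uniq.
move=> e; have [g gK Kg] := fib_bij phi.
rewrite mem_fibre_seq -{1}[e]Kg mem_map ?mem_fibre_seq; last exact: bij_inj (fib_bij phi).
by rewrite -(fib_source phi) Kg.
Qed.

End FibreSums.

Lemma sum_span_comp (M : nmodType) (X Y Z : choiceType) (Q : Defs.span X Y) (Q' : Defs.span Y Z) x
    (F : Q -> Q' -> M) :
  \sum_(c <- fibre_seq (span_comp Q Q') x) F (val c).1 (val c).2 =
  \sum_(e <- fibre_seq Q x) \sum_(e' <- fibre_seq Q' (target e)) F e e'.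
Proof.
transitivity (\sum_(p <- [seq (e, e') | e <- fibre_seq Q x,
    e' <- fibre_seq Q' (target e)]) F p.1 p.2).
  rewrite -(big_map (fun c : span_comp Q Q' => val c) xpredT (fun p => F p.1 p.2)).
  apply: perm_big; apply: uniq_perm.
  - by rewrite map_inj_uniq ?fibre_seq_uniq //; apply: val_inj.
  - apply: allpairs_uniq_dep => [|? _|[? ?] [? ?] _ _ [-> ->]] //;
      exact: fibre_seq_uniq.
  case=> e e'; apply/mapP/allpairsPdep => [[c + ee']|[a [b [aE bE [-> ->]]]]].
    rewrite mem_fibre_seq => /eqP cx; exists e, e'; rewrite !mem_fibre_seq.
    have := valP c; rewrite -ee' /= => /eqP->; move: cx; rewrite /= -ee' /= => ->.
    by split.
  have ab : target (a, b).1 == source (a, b).2 by rewrite /= eq_sym -mem_fibre_seq.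
  by exists (Sub (a, b) ab : span_comp Q Q') => //; rewrite mem_fibre_seq /= -mem_fibre_seq.
by rewrite big_allpairs_dep.
Qed.

Section FaceSums.
Context (X : burnside_object) (M : nmodType).

Lemma sum_split m l k (U : face m k) (V : face m l) (W : face l k)
    (h : splits U V W) (sVU : val V \subset val U) (x : cells X m)
    (F : bd X V -> bd X W -> M) :
  \sum_(s <- fibre_seq (bd X U) x) F (lam sVU s) (back h s) =
  \sum_(r <- fibre_seq (bd X V) x) \sum_(s <- fibre_seq (bd X W) (target r)) F r s.
Proof.
rewrite -sum_span_comp -(sum_fibrewise_bijection (mu h)).
by apply: eq_bigr => s _; rewrite -(mu_front h).
Qed.

(** Faces with the same set but formally distinct codegrees are interchangeable in sums of
    quantities defined uniformly in the codegree. *)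
Lemma sum_face_eq m k k' (U : face m k) (U' : face m k') (x : cells X m)
    (G : forall j (F : face m j), bd X F -> M) : val U = val U' ->
  \sum_(s <- fibre_seq (bd X U) x) G _ _ s = \sum_(s <- fibre_seq (bd X U') x) G _ _ s.
Proof.
move=> e; have ek := face_codegree e; subst k'.
by have -> : U = U' by apply: val_inj.
Qed.

End FaceSums.

Section Evaluation.
Context (X : burnside_object).

Lemma chain_liftE (R : nzRingType) (M : lmodType R) (F : forall m, cells X m -> M) m
    (x : cells X m) : chain_lift F << simplex_of x >> = F m x.
Proof. by rewrite /chain_lift /= liftU scale1r. Qed.

Lemma chain_ofE (R : nzRingType) (K : choiceType) k (Q : Defs.span K (cells X k)) x :
  chain_of (span_linear Q << x >>) =
  \sum_(e <- fibre_seq Q x) (<< simplex_of (target e) >> : chain R X).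
Proof.
rewrite /span_linear liftU scale1r fibre_sumE /chain_of linear_sum.
by apply: eq_bigr => e _; rewrite /= liftU scale1r.
Qed.

Lemma cochain_ext (f g : {linear chain F2 X -> F2^o}) :
  (forall m (x : cells X m), f << simplex_of x >> = g << simplex_of x >>) -> f =1 g.
Proof.
move=> fg c; rewrite -(freeg_sumE c) !linear_sum; apply: eq_bigr => -[m x] _.
have -> : (<< coeff (existT _ m x) c *g (existT _ m x) >> : chain F2 X) =
  coeff (existT _ m x) c *: (<< simplex_of x >> : chain F2 X).
  by apply/eqP/freeg_eqP => z; rewrite coeffZ !coeffU mul1r.
by rewrite !linearZ fg.
Qed.

Lemma cochain_tensorE (a b : cochain X) (y z : simplex X) :
  cochain_tensor a b << (y, z) >> = a << y >> * b << z >>.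
Proof. by rewrite /cochain_tensor /= liftU scale1r. Qed.

Definition value (a : cochain X) m (x : cells X m) : 'F_2 := a << simplex_of x >>.

Lemma coboundary_simplex (a : cochain X) m (x : cells X m) :
  coboundary a << simplex_of x >> =
  \sum_(i < m) \sum_(r <- fibre_seq (bd X (face_of [set i])) x) value a (target r).
Proof.
rewrite -[LHS]/(a (boundary F2 X _)) /boundary chain_liftE linear_sum; apply: eq_bigr => i _.
rewrite /face_chain chain_ofE linearZ linear_sum /=.
have -> : (-1) ^+ i = 1 :> F2 by rewrite -signr_odd; case: (odd i) => //; apply/val_inj.
by rewrite scale1r.
Qed.

End Evaluation.

(** * Removing vertices from a pair of faces *)

Section LinkSums.
Context (m l : nat) (J : face m l).

Lemma sum_gap (M : nmodType) (F : 'I_m -> M) :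
  \sum_(j < l) F (gap J j) = \sum_(u | u \notin val J) F u.
Proof.
rewrite (eq_bigl (mem (gap J @: setT))) => [|u].
  rewrite big_imset /=; last by move=> ? ? _ _; apply: gap_inj.
  by apply: eq_bigl => j; rewrite inE.
apply/idP/imsetP => [/gap_onto[j ->]|[j _ ->]]; last exact: gapN.
by exists j.
Qed.

Lemma sum_link (M : nmodType) (F : {set 'I_m} -> M) :
  \sum_(A : {set 'I_l}) F (val J :|: gap J @: A) = \sum_(A : {set 'I_m} | val J \subset A) F A.
Proof.
pose h (A : {set 'I_l}) := val J :|: gap J @: A.
have hK A : gap J @^-1: h A = A.
  apply/setP => j; rewrite !inE (negbTE (gapN _ _)) /=.
  by rewrite mem_imset //; apply: gap_inj.
rewrite (eq_bigl (mem (h @: setT))) => [|A].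
  rewrite big_imset /=; last by move=> A B _ _ e; rewrite -(hK A) e hK.
  by apply: eq_bigl => A; rewrite inE.
apply/idP/imsetP => [sA|[B _ ->]]; last exact: subsetUl.
exists (gap J @^-1: A) => //; apply/setP => u; rewrite !inE.
have [/(subsetP sA)->//|/gap_onto[j ->] /=] := boolP (u \in val J).
by rewrite mem_imset ?inE //; apply: gap_inj.
Qed.

(** Joining J shifts both the position of an entry and the number of entries before it by
    the number of elements of J below it, so parities of indices do not change. *)
Lemma rank_in_link (D : {set 'I_l}) (j : 'I_l) :
  (gap J j + rank_in (val J :|: gap J @: D) (gap J j) =
   j + rank_in D j + #|[set v in val J | (v < gap J j)%N]|.*2)%N.
Proof.
set c := #|[set v in val J | _]|.
have ec : (gap J j = j + c :> nat)%N.
  have le : (c <= gap J j)%N.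
    rewrite -[X in (_ <= X)%N](card_ord_lt (gap J j)); apply: subset_leq_card.
    by apply/subsetP => v; rewrite !inE => /andP[].
  by rewrite -{1}(subnK le) rank_gap.
have -> : rank_in (val J :|: gap J @: D) (gap J j) = (c + rank_in D j)%N.
  rewrite /rank_in -(cardsID (val J)); congr (_ + _)%N.
    by apply: eq_card => v; rewrite !inE; case: (v \in val J); rewrite ?andbF ?andbT.
  rewrite -(card_imset _ (@gap_inj _ _ J)); apply: eq_card => v.
  apply/idP/imsetP => [|[i + ->]].
    rewrite !inE => /and3P[vJ + vj]; rewrite (negbTE vJ) /= => /imsetP[i iD ev].
    by exists i; rewrite // inE iD -(gap_lt J) -ev.
  by rewrite !inE gapN gap_lt => /andP[iD ->]; rewrite imset_f // orbT.
by rewrite {1}ec -addnn [(c + rank_in D j)%N]addnC addnACA.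
Qed.

Lemma mem_link (D : {set 'I_l}) (j : 'I_l) :
  (gap J j \in val J :|: gap J @: D) = (j \in D).
Proof. by rewrite inE (negbTE (gapN J j)) mem_imset //; apply: gap_inj. Qed.

Lemma admissible_link (A B : {set 'I_l}) :
  admissible (val J :|: gap J @: A) (val J :|: gap J @: B) = admissible A B.
Proof.
have par j : odd (gap J j + (rank_in (val J :|: gap J @: (A :|: B)) (gap J j)).+1) =
    odd (j + (rank_in (A :|: B) j).+1).
  by rewrite !addnS /= rank_in_link oddD odd_double addbF.
have eU : (val J :|: gap J @: A) :|: (val J :|: gap J @: B) =
    val J :|: gap J @: (A :|: B) by rewrite imsetU setUACA setUid.
apply/forallP/forallP => h u.
  by have := h (gap J u); rewrite eU !mem_link par.
have [uJ|/gap_onto[j ->]] := boolP (u \in val J); first by rewrite !inE uJ.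
by rewrite eU !mem_link par; apply: h.
Qed.

Lemma card_link (A : {set 'I_l}) : #|val J :|: gap J @: A| = (#|val J| + #|A|)%N.
Proof.
apply/eqP; rewrite -(eqn_add2r (l - #|A|)).
have := join_face_subproof J (face_of A); rewrite /= => /eqP->.
by rewrite -addnA (eqP (face_of_subproof A)) (eqP (valP J)).
Qed.

End LinkSums.

Section CoveringSums.
Context (m : nat) (M : nmodType).

Lemma sum_cover (F : {set 'I_m} -> 'I_m -> M) :
  \sum_(A : {set 'I_m}) \sum_(u | u \notin A) F A u =
  \sum_(A : {set 'I_m}) \sum_(u | u \in A) F (A :\ u) u.
Proof.
rewrite (exchange_big_dep xpredT) //= [RHS](exchange_big_dep xpredT) //=.
apply: eq_bigr => u _.
rewrite (reindex_onto (fun A : {set 'I_m} => A :\ u) (fun A => u |: A)) /=; last first.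
  by move=> A uA; rewrite setU1K.
apply: eq_bigl => A; rewrite setD11 /=.
by apply/eqP/idP => [<-|/setD1K//]; rewrite setU11.
Qed.

End CoveringSums.

Section FaceExpansion.
Context (X : ordered_object) (m : nat) (x : cells X m).
Implicit Types (a b : cochain X).

Lemma face_of_sub (A B : {set 'I_m}) : A \subset B -> val (face_of A) \subset val (face_of B).
Proof. by []. Qed.

(** A face of the target of s in d_A, together with s, is an element of d_(u |: A). *)
Lemma sum_coboundary (A : {set 'I_m}) (F : bd X (face_of A) -> 'F_2) a :
  \sum_(s <- fibre_seq (bd X (face_of A)) x) F s * value (coboundary a) (target s) =
  \sum_(u | u \notin A) \sum_(s <- fibre_seq (bd X (face_of (u |: A))) x)
     F (lam (face_of_sub (subsetUr [set u] A)) s) * value a (target s).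
Proof.
(* Defined for faces V of any codegree, so that the face may be replaced below. *)
pose G k (V : face m k) (s : bd X V) : 'F_2 :=
  if @idP (val (face_of A) \subset val V) is ReflectT h then F (lam h s) * value a (target s)
  else 0.
have GE k (V : face m k) (h : val (face_of A) \subset val V) (s : bd X V) :
    G k V s = F (lam h s) * value a (target s).
  by rewrite /G; case: {-}_ / idP => // h'; rewrite (bool_irrelevance h' h).
transitivity (\sum_(j < m - #|A|)
   \sum_(s <- fibre_seq (bd X (face_of (gap (face_of A) j |: A))) x) G _ _ s).
  under eq_bigr do rewrite /value coboundary_simplex mulr_sumr.
  rewrite exchange_big; apply: eq_bigr => j _ /=.
  under eq_bigr do rewrite mulr_sumr.
  pose H := join_face (face_of A) (face_of [set j]).
  have h := join_splits (face_of A) (face_of [set j]).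
  have sH := splits_sub h.
  rewrite -(sum_split h sH x (fun s r => F s * value a (target r))).
  transitivity (\sum_(s <- fibre_seq (bd X H) x) G _ _ s).
    by apply: eq_bigr => s _; rewrite (GE _ _ sH) /value back_target.
  by apply: sum_face_eq; rewrite /= imset_set1 setUC.
rewrite (sum_gap (face_of A)
  (fun u => \sum_(s <- fibre_seq (bd X (face_of (u |: A))) x) G _ _ s)) /=.
by apply: eq_bigr => u uA; apply: eq_bigr => s _;
  rewrite (GE _ _ (face_of_sub (subsetUr [set u] A))).
Qed.

(** The triples (r, s, t) on the left are the pairs of elements of d_U and d_V with the same
    front piece r on J. *)
Lemma sum_common_front l k k' (J : face m l) (U : face m k) (V : face m k')
    (WU : face l k) (WV : face l k') (hU : splits U J WU) (hV : splits V J WV)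
    (F : bd X WU -> bd X WV -> 'F_2) :
  \sum_(r <- fibre_seq (bd X J) x) \sum_(s <- fibre_seq (bd X WU) (target r))
     \sum_(t <- fibre_seq (bd X WV) (target r)) F s t =
  \sum_(s <- fibre_seq (bd X U) x) \sum_(t <- fibre_seq (bd X V) x)
     (agree s t (val J))%:R * F (back hU s) (back hV t).
Proof.
have sU := splits_sub hU; have sV := splits_sub hV.
rewrite -(sum_split hU sU x (fun r s =>
  \sum_(t <- fibre_seq (bd X WV) (target r)) F s t)).
rewrite big_seq [RHS]big_seq; apply: eq_bigr => s; rewrite mem_fibre_seq => sx.
under [RHS]eq_bigr do rewrite (agreeE s _ J sU sV) //.
rewrite (sum_split hV sV x (fun r t => (lam sU s == r)%:R * F (back hU s) t)).
rewrite (bigD1_seq (lam sU s)) ?fibre_seq_uniq //= ?mem_fibre_seq ?lam_source //.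
rewrite [X in _ = _ + X]big1_seq ?addr0 => [|r /andP[/negbTE rs _]].
  by apply: eq_bigr => t _; rewrite eqxx mul1r.
by apply: big1 => t _; rewrite eq_sym rs mul0r.
Qed.

End FaceExpansion.

(** * Values of the operations on simplices *)

Section CupValue.
Context (X : ordered_object).
Implicit Types (a b : cochain X) (i : int).

Definition signed_count m k k' (U : face m k) (V : face m k') (s : bd X U) (t : bd X V)
    (e : bool) (W Z : {set 'I_m}) : 'F_2 :=
  chain_count (agree s t) (signed_good s t e) W Z.

(** The value of a (x) b on the chain \sum K(s, t) target(s) (x) target(t): all the
    operations below take this form, and are compared kernel by kernel. *)
Definition face_pairing m (x : cells X m) a b
    (K : forall A B : {set 'I_m}, bd X (face_of A) -> bd X (face_of B) -> 'F_2) : 'F_2 :=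
  \sum_(A : {set 'I_m}) \sum_(B : {set 'I_m})
    \sum_(s <- fibre_seq (bd X (face_of A)) x)
      \sum_(t <- fibre_seq (bd X (face_of B)) x)
        K A B s t * (value a (target s) * value b (target t)).

(** #|A| + #|B| = n - i for n = m - 1, written without subtraction. *)
Definition of_size m i (A B : {set 'I_m}) : bool := (#|A| + #|B|)%:Z + i + 1 == m%:Z.

Lemma cup_sequences i a b m (x : cells X m) :
  cup i a b << simplex_of x >> =
  if m%:Z - 1 - i is Posz q then
    \sum_(U : q.-tuple 'I_m | at_most_twice U)
      \sum_(s <- fibre_seq (bd X (face_of (minus_part U))) x)
        \sum_(t <- fibre_seq (bd X (face_of (plus_part U))) x)
          #|positive_chains s t|%:R * (value a (target s) * value b (target t))
  else 0.
Proof.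
rewrite -[LHS]/(cochain_tensor a b (nabla X i _)) /nabla chain_liftE.
case: (m%:Z - 1 - i) => [q|q]; last by rewrite linear0.
rewrite linear_sum; apply: eq_bigr => U _.
rewrite fibre_sumE linear_sum; apply: eq_bigr => s _.
rewrite fibre_sumE linear_sum; apply: eq_bigr => t _.
by rewrite linearZ cochain_tensorE.
Qed.

Lemma cup_simplex i a b m (x : cells X m) :
  cup i a b << simplex_of x >> =
  face_pairing x a b (fun A B s t =>
    (of_size i A B && admissible A B)%:R *
    signed_count s t (odd (m + #|A| + #|B|)) set0 (A :&: B)).
Proof.
pose F (A B : {set 'I_m}) : 'F_2 :=
  \sum_(s <- fibre_seq (bd X (face_of A)) x)
    \sum_(t <- fibre_seq (bd X (face_of B)) x)
      #|positive_chains s t|%:R * (value a (target s) * value b (target t)).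
have -> : face_pairing x a b (fun A B s t =>
    (of_size i A B && admissible A B)%:R *
    signed_count s t (odd (m + #|A| + #|B|)) set0 (A :&: B)) =
  \sum_(A : {set 'I_m}) \sum_(B : {set 'I_m}) (of_size i A B && admissible A B)%:R * F A B.
  apply: eq_bigr => A _; apply: eq_bigr => B _.
  rewrite mulr_sumr big_seq [RHS]big_seq; apply: eq_bigr => s; rewrite mem_fibre_seq => /eqP sx.
  rewrite mulr_sumr big_seq [RHS]big_seq; apply: eq_bigr => t; rewrite mem_fibre_seq => /eqP tx.
  by rewrite card_positive_chains ?sx ?tx // -mulrA.
rewrite cup_sequences [RHS]pair_big /=.
case eq: (m%:Z - 1 - i) => [q|q]; last first.
  rewrite big1 // => -[A B] _ /=; rewrite /of_size; case: eqP => [e|_]; last by rewrite mul0r.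
  by move: eq; rewrite -e !addrK.
rewrite (sum_at_most_twice _ F) big_mkcond; apply: eq_bigr => -[A B] _ /=.
have -> : of_size i A B = (#|A| + #|B| == q)%N.
  by rewrite /of_size eq_sym -!subr_eq eq eq_sym.
by case: ifP; rewrite ?mul1r ?mul0r.
Qed.


Lemma eq_face_pairing m (x : cells X m) a b
    (K K' : forall A B : {set 'I_m}, bd X (face_of A) -> bd X (face_of B) -> 'F_2) :
    (forall A B s t, source s = x -> source t = x -> K A B s t = K' A B s t) ->
  face_pairing x a b K = face_pairing x a b K'.
Proof.
move=> eK; apply: eq_bigr => A _; apply: eq_bigr => B _.
rewrite big_seq [RHS]big_seq; apply: eq_bigr => s; rewrite mem_fibre_seq => /eqP sx.
rewrite big_seq [RHS]big_seq; apply: eq_bigr => t; rewrite mem_fibre_seq => /eqP tx.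
by rewrite eK.
Qed.

Lemma face_pairingC m (x : cells X m) a b
    (K : forall A B : {set 'I_m}, bd X (face_of A) -> bd X (face_of B) -> 'F_2) :
  face_pairing x b a K = face_pairing x a b (fun A B s t => K B A t s).
Proof.
rewrite /face_pairing exchange_big; apply: eq_bigr => A _; apply: eq_bigr => B _ /=.
rewrite exchange_big; apply: eq_bigr => s _; apply: eq_bigr => t _ /=.
by rewrite [X in _ * X]mulrC.
Qed.

Lemma face_pairingD m (x : cells X m) a b
    (K K' : forall A B : {set 'I_m}, bd X (face_of A) -> bd X (face_of B) -> 'F_2) :
  face_pairing x a b K + face_pairing x a b K' =
  face_pairing x a b (fun A B s t => K A B s t + K' A B s t).
Proof.
rewrite -big_split; apply: eq_bigr => A _; rewrite -big_split; apply: eq_bigr => B _.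
rewrite -big_split; apply: eq_bigr => s _; rewrite -big_split; apply: eq_bigr => t _ /=.
by rewrite mulrDl.
Qed.

Section SignedCount.
Context (m k k' : nat) (U : face m k) (V : face m k').
Context (s : bd X U) (t : bd X V).

Lemma signed_countC e W Z : signed_count t s e W Z = signed_count s t (~~ e) W Z.
Proof.
by apply: eq_chain_count => [A _|A B _]; [apply: agreeC|apply: signed_goodC].
Qed.

Lemma signed_count_lam j (U' : face m j) (sU : val U' \subset val U) e (W Z : {set 'I_m}) :
    W :|: Z \subset val U' -> W :|: Z \subset val V ->
  signed_count (lam sU s) t e W Z = signed_count s t e W Z.
Proof.
move=> sG sV; apply: eq_chain_count => [A sA|A B sAB].
  by apply: agree_lam; apply: subset_trans sG.
by apply: signed_good_lam; [apply: subset_trans sG|apply: subset_trans sV].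
Qed.

Lemma signed_count_disagree e (W Z : {set 'I_m}) :
  ~~ agree s t W -> signed_count s t e W Z = 0.
Proof.
move=> nW; rewrite /signed_count; have [->|Z0] := eqVneq Z set0.
  by rewrite chain_count0 (negbTE nW).
by rewrite chain_countE // /signed_good (negbTE nW) mul0r.
Qed.

Lemma signed_count_boundary e (W Z : {set 'I_m}) :
    W :|: Z \subset val U -> W :|: Z \subset val V ->
  signed_count s t e W Z + signed_count s t (~~ e) W Z =
  \sum_(w in Z) (signed_count s t (~~ e) W (Z :\ w)
                 + signed_count s t (~~ e) (w |: W) (Z :\ w)).
Proof.
move=> sU sV; rewrite /signed_count.
have [->|Z0] := eqVneq Z set0; first by rewrite !chain_count0 big_set0 addrr2.
apply: (chain_count_boundary (D := val U :&: val V)) => //.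
- exact: agree_sub.
- by move=> A B; rewrite subsetI => /andP[sAU sAV]; apply: signed_good_xor.
- by move=> A B _; apply: signed_good_good.
- by rewrite subsetI; apply/andP; split.
Qed.

End SignedCount.

(** The chains entering the comultiplication of a face of x: if s and t have a common front
    piece on J, chains for their back pieces are chains for (s, t) whose first members
    contain J. *)
Lemma signed_count_back m l k k' (U : face m k) (V : face m k') (J : face m l)
    (WU : face l k) (WV : face l k') (hU : splits U J WU) (hV : splits V J WV)
    (s : bd X U) (t : bd X V) e (Z : {set 'I_l}) :
    agree s t (val J) -> Z \subset val WU -> Z \subset val WV ->
  signed_count (back hU s) (back hV t) e set0 Z =
  signed_count s t e (val J) (gap J @: Z).
Proof.
move=> est sU sV.
rewrite -[val J in RHS]setU0 -[X in val J :|: X](imset0 (gap J)).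
apply: chain_count_transport; first exact: gap_inj.
  move=> A; rewrite set0U => sA; apply: agree_back => //.
    exact: subset_trans sA sU.
  exact: subset_trans sA sV.
move=> A B; rewrite set0U => sA; apply: signed_good_back => //.
  exact: subset_trans sA sU.
exact: subset_trans sA sV.
Qed.

Lemma face_pairing_coboundary m (x : cells X m) a b
    (c : {set 'I_m} -> {set 'I_m} -> 'F_2) (e : {set 'I_m} -> {set 'I_m} -> bool) :
  face_pairing x (coboundary a) b (fun A B s t =>
    c A B * signed_count s t (e A B) set0 (A :&: B)) =
  face_pairing x a b (fun A B s t =>
    \sum_(u in A) c (A :\ u) B * signed_count s t (e (A :\ u) B) set0 ((A :\ u) :&: B)).
Proof.
rewrite /face_pairing exchange_big [RHS]exchange_big; apply: eq_bigr => B _ /=.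
pose H (A' A : {set 'I_m}) := \sum_(s <- fibre_seq (bd X (face_of A')) x)
   \sum_(t <- fibre_seq (bd X (face_of B)) x)
     (c A B * signed_count s t (e A B) set0 (A :&: B)) * (value a (target s) * value b (target t)).
transitivity (\sum_(A : {set 'I_m}) \sum_(u | u \notin A) H (u |: A) A).
  apply: eq_bigr => A _; pose F (s : bd X (face_of A)) := \sum_(t <- fibre_seq (bd X (face_of B)) x)
     (c A B * signed_count s t (e A B) set0 (A :&: B)) * value b (target t).
  transitivity (\sum_(s <- fibre_seq (bd X (face_of A)) x) F s * value (coboundary a) (target s)).
    apply: eq_bigr => s _; rewrite mulr_suml; apply: eq_bigr => t _.
    by rewrite -[RHS]mulrA [X in _ = _ * X]mulrC.
  rewrite sum_coboundary; apply: eq_bigr => u _; apply: eq_bigr => s _.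
  rewrite mulr_suml; apply: eq_bigr => t _.
  rewrite -mulrA [X in _ * X]mulrC; congr (_ * _ * _).
  by apply: signed_count_lam; rewrite set0U ?subsetIl ?subsetIr.
rewrite sum_cover; apply: eq_bigr => A _.
transitivity (\sum_(u in A) H A (A :\ u)).
  by apply: eq_bigr => u uA; rewrite setD1K.
rewrite exchange_big; apply: eq_bigr => s _; rewrite exchange_big; apply: eq_bigr => t _ /=.
by rewrite mulr_suml.
Qed.

Lemma of_size_remove m i (A B : {set 'I_m}) u : u \in A ->
  of_size i (A :\ u) B = of_size (i - 1) A B.
Proof.
move=> uA; rewrite /of_size [in RHS]addrA subrK (cardsD1 u A) uA -addnA add1n -addn1.
by rewrite [in RHS]PoszD addrAC.
Qed.

Lemma of_sizeC m i (A B : {set 'I_m}) : of_size i A B = of_size i B A.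
Proof. by rewrite /of_size addnC. Qed.

Lemma parity_remove m (A B : {set 'I_m}) u : u \in A ->
  odd (m + #|A :\ u| + #|B|) = ~~ odd (m + #|A| + #|B|).
Proof. by move=> uA; rewrite (cardsD1 u A) uA add1n addnS addSn /= negbK. Qed.

(** A is the set of the tensor factor after taking the boundary, so (A :\ u, B) is the pair
    before; removing u reverses the parity that fixes the sign. *)
Lemma cup_coboundaryl i a b m (x : cells X m) :
  cup i (coboundary a) b << simplex_of x >> =
  face_pairing x a b (fun A B s t => (of_size (i - 1) A B)%:R *
    \sum_(u in A | admissible (A :\ u) B)
      signed_count s t (~~ odd (m + #|A| + #|B|)) set0 ((A :\ u) :&: B)).
Proof.
rewrite cup_simplex face_pairing_coboundary; apply: eq_face_pairing => A B s t _ _.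
rewrite mulr_sumr big_mkcondr; apply: eq_bigr => u uA.
rewrite of_size_remove // parity_remove //.
by case: (admissible _ _); rewrite ?andbT ?andbF ?mul0r.
Qed.

Lemma cup_coboundaryr i a b m (x : cells X m) :
  cup i a (coboundary b) << simplex_of x >> =
  face_pairing x a b (fun A B s t => (of_size (i - 1) A B)%:R *
    \sum_(u in B | admissible A (B :\ u))
      signed_count s t (~~ odd (m + #|A| + #|B|)) set0 (A :&: (B :\ u))).
Proof.
rewrite cup_simplex face_pairingC.
rewrite (@eq_face_pairing _ _ _ _ _ (fun B A t s => (of_size i A B && admissible A B)%:R *
  signed_count t s (~~ odd (m + #|A| + #|B|)) set0 (B :&: A))); last first.
  by move=> B A t s _ _; rewrite signed_countC setIC.
rewrite (face_pairing_coboundary _ _ _ (fun B A => (of_size i A B && admissible A B)%:R)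
  (fun B A => ~~ odd (m + #|A| + #|B|))) face_pairingC.
apply: eq_face_pairing => A B s t _ _.
rewrite mulr_sumr big_mkcondr; apply: eq_bigr => u uB.
rewrite of_sizeC of_size_remove // of_sizeC signed_countC setIC addnAC parity_remove // addnAC.
by case: (admissible _ _); rewrite ?andbT ?andbF ?mul0r // negbK.
Qed.

Lemma size_shift (p q l m : nat) i : m = l.+1 ->
  ((p.+1 + q.+1)%:Z + (i - 1) + 1 == m%:Z) = ((p + q)%:Z + i + 1 == l%:Z).
Proof.
move=> ->; rewrite addrA subrK addSn addnS -[(p + q).+2]addn1 -[(p + q).+1]addn1 -[l.+1]addn1.
by rewrite !PoszD [in LHS]addrAC (inj_eq (addIr _)) [in LHS]addrAC.
Qed.

Lemma parity_shift (p q l m : nat) : m = l.+1 ->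
  ~~ odd (m + p.+1 + q.+1) = odd (l + p + q).
Proof. by move=> ->; rewrite !addnS !addSn /= !negbK. Qed.

(** The pairs of faces of a face d_j x are the pairs of faces of x with the same piece on
    {j}; the condition that the pieces coincide is absorbed in the count, which vanishes
    otherwise ([signed_count_disagree]).  Passing to degree m - 2 and removing j from both A and
    B changes the parity of m + #|A| + #|B| by 3. *)
Lemma coboundary_cup i a b m (x : cells X m) :
  coboundary (cup i a b) << simplex_of x >> =
  face_pairing x a b (fun A B s t => (of_size (i - 1) A B && admissible A B)%:R *
    \sum_(j in A :&: B)
      signed_count s t (~~ odd (m + #|A| + #|B|)) [set j] ((A :&: B) :\ j)).
Proof.
rewrite coboundary_simplex.
pose H j (A B : {set 'I_m}) := \sum_(s <- fibre_seq (bd X (face_of A)) x)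
   \sum_(t <- fibre_seq (bd X (face_of B)) x)
     ((of_size (i - 1) A B && admissible A B)%:R *
      signed_count s t (~~ odd (m + #|A| + #|B|)) [set j] ((A :&: B) :\ j)) *
     (value a (target s) * value b (target t)).
transitivity (\sum_(j < m) \sum_(A : {set 'I_m} | [set j] \subset A)
   \sum_(B : {set 'I_m} | [set j] \subset B) H j A B).
  apply: eq_bigr => j _; pose J := face_of [set j].
  rewrite -(sum_link J (fun A => \sum_(B : {set 'I_m} | [set j] \subset B) H j A B)).
  under [RHS]eq_bigr do rewrite -(sum_link J).
  rewrite (eq_bigr _ (fun r _ => cup_simplex i a b (target r))) /face_pairing.
  rewrite exchange_big; apply: eq_bigr => A _; rewrite exchange_big; apply: eq_bigr => B _ /=.
  pose UA := join_face J (face_of A); pose UB := join_face J (face_of B).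
  have hA := join_splits J (face_of A); have hB := join_splits J (face_of B).
  rewrite (sum_common_front x hA hB (fun s t =>
     ((of_size i A B && admissible A B)%:R *
      signed_count s t (odd (m - #|[set j]| + #|A| + #|B|)) set0 (A :&: B)) *
     (value a (target s) * value b (target t)))).
  pose G k k' (U : face m k) (V : face m k') (s : bd X U) (t : bd X V) : 'F_2 :=
    ((of_size (i - 1) (val U) (val V) && admissible (val U) (val V))%:R *
      signed_count s t (~~ odd (m + #|val U| + #|val V|)) [set j] ((val U :&: val V) :\ j)) *
     (value a (target s) * value b (target t)).
  transitivity (\sum_(s <- fibre_seq (bd X UA) x) \sum_(t <- fibre_seq (bd X UB) x)
    G _ _ _ _ s t); last first.
    rewrite (@sum_face_eq _ _ _ _ _ UA (face_of (val UA)) _ (fun k U s =>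
      \sum_(t <- fibre_seq (bd X UB) x) G _ _ _ _ s t)) //.
    apply: eq_bigr => s _.
    by rewrite (@sum_face_eq _ _ _ _ _ UB (face_of (val UB)) _ (fun k V t => G _ _ _ _ s t)).
  apply: eq_bigr => s _; apply: eq_bigr => t _; rewrite /G.
  rewrite /value !back_target mulrA; congr (_ * _).
  have cA : #|val UA| = #|A|.+1 := etrans (card_link J A) (congr1 (addn^~ _) (cards1 j)).
  have cB : #|val UB| = #|B|.+1 := etrans (card_link J B) (congr1 (addn^~ _) (cards1 j)).
  have em : m = (m - #|[set j]|).+1.
    by rewrite cards1 subn1 prednK // (leq_ltn_trans _ (ltn_ord j)).
  have -> : of_size (i - 1) (val UA) (val UB) = of_size i A B.
    rewrite /of_size cA cB; apply: size_shift em.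
  have -> : admissible (val UA) (val UB) = admissible A B by apply: admissible_link.
  rewrite mulrCA; congr (_ * _).
  have -> : ~~ odd (m + #|val UA| + #|val UB|) = odd (m - #|[set j]| + #|A| + #|B|).
    by rewrite cA cB; apply: parity_shift em.
  have -> : (val UA :&: val UB) :\ j = gap J @: (A :&: B).
    rewrite -(setUIr [set j]) -imsetI; last by move=> ? ? _ _; apply: gap_inj.
    by rewrite setU1K //; apply/imsetP => -[v _ ev]; have := gapN J v; rewrite -ev set11.
  have [est|nst] := boolP (agree s t (val J)); last first.
    by rewrite mul0r signed_count_disagree.
  rewrite mul1r signed_count_back //; first exact: subsetIl.
  exact: subsetIr.
rewrite (exchange_big_dep xpredT) //=; apply: eq_bigr => A _.
rewrite (exchange_big_dep xpredT) //=; apply: eq_bigr => B _.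
rewrite /H exchange_big; apply: eq_bigr => s _; rewrite exchange_big; apply: eq_bigr => t _ /=.
rewrite mulr_sumr mulr_suml; apply: eq_bigl => j.
by rewrite !sub1set inE.
Qed.

End CupValue.

(** * The Leibniz rule *)

Section Multiplication.
Context (X : ordered_object).
Implicit Types (a b : cochain X) (i : int).

Lemma face_pairingDl m (x : cells X m) a a' b K :
  face_pairing x (a \+ a') b K = face_pairing x a b K + face_pairing x a' b K.
Proof.
rewrite -big_split; apply: eq_bigr => A _; rewrite -big_split; apply: eq_bigr => B _.
rewrite -big_split; apply: eq_bigr => s _; rewrite -big_split; apply: eq_bigr => t _ /=.
by rewrite -mulrDr -mulrDl.
Qed.

Lemma cupDl i a a' b : cup i (a \+ a') b =1 cup i a b \+ cup i a' b.
Proof.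
apply: cochain_ext => m x; rewrite -[RHS]/((cup i a b << simplex_of x >> : 'F_2) + cup i a' b << simplex_of x >>).
by rewrite !cup_simplex face_pairingDl.
Qed.

Lemma cupDr i a b b' : cup i a (b \+ b') =1 cup i a b \+ cup i a b'.
Proof.
apply: cochain_ext => m x; rewrite -[RHS]/((cup i a b << simplex_of x >> : 'F_2) + cup i a b' << simplex_of x >>) !cup_simplex.
by rewrite face_pairingC face_pairingDl; congr (_ + _); rewrite face_pairingC.
Qed.

Lemma cup_degree i p q a b :
  has_degree p a -> has_degree q b -> has_degree (p + q - i) (cup i a b).
Proof.
move=> ha hb m x mpq; rewrite cup_simplex /face_pairing.
rewrite big1 // => A _; rewrite big1 // => B _; rewrite big1 // => s _; rewrite big1 // => t _.
have [sz|] := boolP (of_size i A B); last by rewrite !mul0r.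
have [ea|na] := eqVneq ((m - #|A|)%:Z - 1) p; last by rewrite /value ha // mul0r mulr0.
have [eb|nb] := eqVneq ((m - #|B|)%:Z - 1) q; last by rewrite /value hb // !mulr0.
have lA : (#|A| <= m)%N by rewrite -[m in (_ <= m)%N]card_ord max_card.
have lB : (#|B| <= m)%N by rewrite -[m in (_ <= m)%N]card_ord max_card.
case/negP: mpq; apply/eqP; rewrite -ea -eb -!subzn //.
move/eqP: sz => <-; rewrite PoszD.
ring.
Qed.

Lemma cup_leibniz i a b :
  coboundary (cup i a b) =1
    cup i (coboundary a) b \+ cup i a (coboundary b) \+ cup (i - 1) a b \+ cup (i - 1) b a.
Proof.
apply: cochain_ext => m x; rewrite -[RHS]/((cup i (coboundary a) b << simplex_of x >> : 'F_2) +
  cup i a (coboundary b) << simplex_of x >> + cup (i - 1) a b << simplex_of x >> + cup (i - 1) b a << simplex_of x >>).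
rewrite coboundary_cup cup_coboundaryl cup_coboundaryr.
rewrite !cup_simplex [X in _ = _ + X]face_pairingC !face_pairingD.
apply: eq_face_pairing => A B s t _ _; rewrite (of_sizeC _ B A).
case: (of_size (i - 1) A B); rewrite /= ?mul0r ?addr0 // !mul1r.
rewrite [(m + #|B| + #|A|)%N]addnAC (signed_countC s t) [B :&: A]setIC.
set e := odd (m + #|A| + #|B|).
rewrite -[RHS]addrA -(@coefficient_identity m A B (signed_count s t (~~ e))
  (signed_count s t e set0 (A :&: B))); first by rewrite addrA addrr2 add0r.
rewrite signed_count_boundary ?set0U ?subsetIl ?subsetIr //.
by apply: eq_bigr => j _; rewrite setU0.
Qed.

Lemma cup_stable_symmetric : stable_symmetric_multiplication (@cup X).
Proof.
split; [exact: cupDl|exact: cupDr| |exact: cup_leibniz].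
by move=> i p q a b; apply: cup_degree.
Qed.

End Multiplication.

(** * Naturality *)

(** An element c = (s, a) of f o d_U restricts to V: f moves the back piece of s past a, which
    gives the element b of f over the target of the front piece, and [map_front] is (lam s, b).
    By compatibility with mu these restrictions correspond, under the bijections f_U, to the
    restrictions of the image of s. *)
Section MapPieces.
Context (X Y : burnside_object) (f : object_map X Y).
Context (m l k : nat) (U : face m k) (V : face m l) (W : face l k) (h : splits U V W).
Context (sVU : val V \subset val U).
Implicit Types (c : span_comp (bd X U) (obj_map f k)).

Fact map_back_subproof c :
  target (back h (val c).1, (val c).2).1 == source (back h (val c).1, (val c).2).2.
Proof. by rewrite /= back_target (valP c). Qed.

Definition map_back c : span_comp (bd X W) (obj_map f k) :=
  exist _ (back h (val c).1, (val c).2) (map_back_subproof c).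

Fact map_front_subproof c :
  target (lam sVU (val c).1, (val (obj_map_bd f W (map_back c))).1).1 ==
  source (lam sVU (val c).1, (val (obj_map_bd f W (map_back c))).1).2.
Proof.
have /= e := fib_source (obj_map_bd f W) (map_back c).
by rewrite /= e (back_source h sVU).
Qed.

Definition map_front c : span_comp (bd X V) (obj_map f l) :=
  exist _ (lam sVU (val c).1, (val (obj_map_bd f W (map_back c))).1)
    (map_front_subproof c).

Lemma map_front_back c :
  [/\ (val (obj_map_bd f V (map_front c))).1 = (val (obj_map_bd f U c)).1,
      (val (obj_map_bd f V (map_front c))).2 = lam sVU (val (obj_map_bd f U c)).2
    & (val (obj_map_bd f W (map_back c))).2 = back h (val (obj_map_bd f U c)).2].
Proof.
have e1 : val (map_back c) = ((val (mu h (val c).1)).2, (val c).2) by [].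
have e2 : val (map_front c) =
    ((val (mu h (val c).1)).1, (val (obj_map_bd f W (map_back c))).1).
  by rewrite (mu_front h sVU).
have /= := obj_map_mu e1 e2.
case=> -> e; split=> //.
  by rewrite -(mu_front h) /= e.
by rewrite /back /= e.
Qed.

End MapPieces.

Section FreeMap.
Context (X Y : ordered_object) (f : object_map X Y).
Hypotheses (f_free : free_map f) (f_ord : order_preserving f).

(** By freeness a is determined by s in an element (s, a), and on the other side the element of
    f over the common source is unique. *)
Lemma map_inj m k (U : face m k) (c c' : span_comp (bd X U) (obj_map f k)) :
    source c = source c' ->
  ((val c).1 == (val c').1) =
  ((val (obj_map_bd f U c)).2 == (val (obj_map_bd f U c')).2).
Proof.
move=> scc'; apply/eqP/eqP => e.
  suff -> : c = c' by [].
  apply: val_inj; rewrite [LHS]surjective_pairing [RHS]surjective_pairing.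
  congr (_, _) => //; apply: f_free.
  by rewrite -(eqP (valP c)) -(eqP (valP c')) e.
suff -> : c = c' by [].
apply: (bij_inj (fib_bij (obj_map_bd f U))); apply: val_inj.
rewrite [LHS]surjective_pairing [RHS]surjective_pairing; congr (_, _) => //.
apply: f_free.
have /= -> := fib_source (obj_map_bd f U) c.
by have /= -> := fib_source (obj_map_bd f U) c'.
Qed.

Lemma map_lt m k (U : face m k) (c c' : span_comp (bd X U) (obj_map f k)) :
    source c = source c' ->
  ord_lt (val c).1 (val c').1 =
  ord_lt (val (obj_map_bd f U c)).2 (val (obj_map_bd f U c')).2.
Proof.
move=> scc'; rewrite /ord_lt -map_inj //; case: eqP => //= ne.
apply/idP/idP => [|le]; first exact: f_ord.
case/orP: (ord_le_total (val c).1 (val c').1) => // /(f_ord (esym scc')) ge.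
by case: ne; apply/eqP; rewrite map_inj //; apply/eqP/ord_le_anti; rewrite le ge.
Qed.

Section TwoFaces.
Context (m k k' : nat) (U : face m k) (V : face m k').
Context (c : span_comp (bd X U) (obj_map f k)) (c' : span_comp (bd X V) (obj_map f k')).
Hypothesis scc' : source c = source c'.
Let s := (val c).1.
Let t := (val c').1.
Let s' := (val (obj_map_bd f U c)).2.
Let t' := (val (obj_map_bd f V c')).2.

Lemma map_agree (W : {set 'I_m}) : agree s' t' W = agree s t W.
Proof.
have [/andP[sU sV]|n] := boolP ((W \subset val U) && (W \subset val V)); last first.
  by apply/idP/idP => a; move: n; rewrite (agree_subl a) (agree_subr a).
pose F := face_of W.
have sFU : val F \subset val U := sU.
have sFV : val F \subset val V := sV.
rewrite (agreeE s' t' F sFU sFV) // (agreeE s t F sFU sFV) //.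
have [_ <- _] := map_front_back (residue_splits sFU) sFU c.
have [_ <- _] := map_front_back (residue_splits sFV) sFV c'.
by rewrite -map_inj //= !lam_source.
Qed.

(** The middle pieces to be compared have a common source because s and t have the same front
    piece on W; this is what [map_lt] requires. *)
Lemma map_less (W G : {set 'I_m}) : W \subset G -> G \subset val U -> G \subset val V ->
  agree s t W -> less s' t' W G = less s t W G.
Proof.
move=> sWG sU sV aW; pose F := face_of G; pose F1 := face_of W.
have sF : val F1 \subset val F := sWG.
have sFU : val F \subset val U := sU.
have sFV : val F \subset val V := sV.
have h := residue_splits sF.
rewrite (lessE s' t' F h sFU sFV) // (lessE s t F h sFU sFV) //.
have [_ <- _] := map_front_back (residue_splits sFU) sFU c.
have [_ <- _] := map_front_back (residue_splits sFV) sFV c'.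
have [_ _ <-] := map_front_back h sF (map_front (residue_splits sFU) sFU c).
have [_ _ <-] := map_front_back h sF (map_front (residue_splits sFV) sFV c').
rewrite -map_lt //= !(back_source h sF).
have s1U := subset_trans sF sFU; have s1V := subset_trans sF sFV.
rewrite (lam_lam _ _ s1U) (lam_lam _ _ s1V).
by move: aW; rewrite (agreeE s t F1 s1U s1V) // => /eqP ->.
Qed.

End TwoFaces.

Lemma map_signed_count m k k' (U : face m k) (V : face m k')
    (c : span_comp (bd X U) (obj_map f k)) (c' : span_comp (bd X V) (obj_map f k'))
    e (W Z : {set 'I_m}) :
    source c = source c' -> W :|: Z \subset val U -> W :|: Z \subset val V ->
  signed_count (val (obj_map_bd f U c)).2 (val (obj_map_bd f V c')).2 e W Z =
  signed_count (val c).1 (val c').1 e W Z.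
Proof.
move=> scc' sU sV; apply: eq_chain_count => [A _|A B sAB]; first exact: map_agree.
rewrite /signed_good !map_agree //; case: (boolP (agree _ _ A)) => //= aA; congr (_ && _).
have sABU := subset_trans sAB sU; have sABV := subset_trans sAB sV.
case: e; first by rewrite map_less // subsetUl.
by rewrite map_less // ?subsetUl // agreeC.
Qed.

Lemma pullback_simplex (a : cochain Y) m (x : cells X m) :
  pullback f a << simplex_of x >> = \sum_(e <- fibre_seq (obj_map f m) x) value a (target e).
Proof.
have e : chain_map F2 f << simplex_of x >> = chain_of (span_linear (obj_map f m) << x >>).
  exact: chain_liftE.
by rewrite -[LHS]/(a (chain_map F2 f _)) e chain_ofE linear_sum.
Qed.

Lemma sum_free m (x : cells X m) (e : obj_map f m) (M : nmodType) (F : obj_map f m -> M) :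
  source e = x -> \sum_(e' <- fibre_seq (obj_map f m) x) F e' = F e.
Proof.
move=> ex; rewrite (bigD1_seq e) ?fibre_seq_uniq ?mem_fibre_seq ?ex //=.
rewrite big1_seq ?addr0 // => e' /andP[ne]; rewrite mem_fibre_seq => /eqP e'x.
by case/eqP: ne; apply: f_free; rewrite e'x.
Qed.

Lemma pullback_cup i (a b : cochain Y) :
  pullback f (cup i a b) =1 cup i (pullback f a) (pullback f b).
Proof.
apply: cochain_ext => m x; rewrite pullback_simplex.
rewrite (eq_bigr _ (fun e _ => cup_simplex i a b (target e))) cup_simplex.
have vE (c : cochain Y) k (y : cells X k) : value (pullback f c) y =
    \sum_(e <- fibre_seq (obj_map f k) y) value c (target e) := pullback_simplex c y.
move: (pullback f a) (pullback f b) (vE a) (vE b) => pa pb paE pbE {vE}.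
rewrite /face_pairing exchange_big; apply: eq_bigr => A _; rewrite exchange_big.
apply: eq_bigr => B _ /=.
pose n (A B : {set 'I_m}) : 'F_2 := (of_size i A B && admissible A B)%:R.
pose o (A B : {set 'I_m}) := odd (m + #|A| + #|B|).
pose P := span_comp (bd X (face_of A)) (obj_map f _).
pose P' := span_comp (bd X (face_of B)) (obj_map f _).
pose Q := span_comp (obj_map f m) (bd Y (face_of A)).
pose Q' := span_comp (obj_map f m) (bd Y (face_of B)).
transitivity (\sum_(c <- fibre_seq P x) \sum_(c' <- fibre_seq P' x)
   n A B * signed_count (val c).1 (val c').1 (o A B) set0 (A :&: B) *
     (value a (target (val c).2) * value b (target (val c').2))); last first.
  pose F (s : bd X (face_of A)) (u : obj_map f (m - #|A|)) := 
    \sum_(c' <- fibre_seq P' x)  n A B * signed_count s (val c').1 (o A B) set0 (A :&: B) *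
     (value a (target u) * value b (target (val c').2)).
  rewrite (sum_span_comp x F); apply: eq_bigr => s _.
  rewrite /F exchange_big /=.
  pose F' (t : bd X (face_of B)) (v : obj_map f (m - #|B|)) :=
    \sum_(u <- fibre_seq (obj_map f (m - #|A|)) (target s))
      n A B * signed_count s t (o A B) set0 (A :&: B) *
     (value a (target u) * value b (target v)).
  rewrite (sum_span_comp x F'); apply: eq_bigr => t _.
  rewrite paE pbE mulr_suml mulr_sumr exchange_big.
  apply: eq_bigr => u _; rewrite mulr_sumr mulr_sumr.
  by apply: eq_bigr.
transitivity (\sum_(d <- fibre_seq Q x) \sum_(d' <- fibre_seq Q' x)
   n A B * signed_count (val d).2 (val d').2 (o A B) set0 (A :&: B) *
     (value a (target (val d).2) * value b (target (val d').2))); last first.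
  rewrite -(sum_fibrewise_bijection (obj_map_bd f (face_of A))).
  rewrite big_seq [RHS]big_seq; apply: eq_bigr => c; rewrite mem_fibre_seq => /eqP sc.
  rewrite -(sum_fibrewise_bijection (obj_map_bd f (face_of B))).
  rewrite big_seq [RHS]big_seq; apply: eq_bigr => c'; rewrite mem_fibre_seq => /eqP sc'.
  have e1 := fib_target (obj_map_bd f (face_of A)) c.
  have e2 := fib_target (obj_map_bd f (face_of B)) c'.
  rewrite -[target (val (obj_map_bd f _ c)).2]/(target (obj_map_bd f _ c)) e1.
  rewrite -[target (val (obj_map_bd f _ c')).2]/(target (obj_map_bd f _ c')) e2.
  by rewrite map_signed_count ?sc ?sc' // set0U ?subsetIl ?subsetIr.
pose F (e : obj_map f m) (s : bd Y (face_of A)) := 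
    \sum_(d' <- fibre_seq Q' x)  n A B * signed_count s (val d').2 (o A B) set0 (A :&: B) *
     (value a (target s) * value b (target (val d').2)).
rewrite (sum_span_comp x F) big_seq [RHS]big_seq; apply: eq_bigr => e.
rewrite mem_fibre_seq => /eqP ex; apply: eq_bigr => s _.
pose F' (e : obj_map f m) (t : bd Y (face_of B)) := 
    n A B * signed_count s t (o A B) set0 (A :&: B) * (value a (target s) * value b (target t)).
by rewrite /F (sum_span_comp x F') (sum_free _ ex).
Qed.

End FreeMap.

(** * Semi-simplicial sets *)

Section Steenrod.
Context (X : ordered_object).
Hypothesis Xsss : semi_simplicial_set X.

(** Elements of d_W are determined by their source: W has positive codegree, as there is no
    simplex of degree -1 for the target of an element. *)
Lemma agree_simplicial m k k' (U : face m k) (V : face m k') (s : bd X U) (t : bd X V)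
    (W : {set 'I_m}) :
  source s = source t -> W \subset val U -> W \subset val V -> agree s t W.
Proof.
move=> st sU sV; have [noX bdX] := Xsss.
pose F := face_of W; have sFU : val F \subset val U := sU.
have sFV : val F \subset val V := sV.
have cells_gt0 n : cells X n -> (0 < n)%N by case: n => // /noX.
rewrite (agreeE s t F sFU sFV) //; apply/eqP.
apply: (bij_inj (bdX _ _ F (cells_gt0 _ (target (lam sFU s))))).
by rewrite !lam_source.
Qed.

Lemma strictly_increasingE m (U : seq 'I_m) :
  at_most_twice U -> strictly_increasing U = (minus_part U :&: plus_part U == set0).
Proof.
move=> twU; have /andP[sU _] := twU.
rewrite /strictly_increasing ltn_sorted_uniq_leq sU andbT map_inj_uniq; last exact: val_inj.
apply/idP/eqP => [uU|e].
  apply/setP => u; rewrite [RHS]inE in_setI; have := count_parts twU u.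
  by rewrite count_uniq_mem //; do 3![case: (u \in _)].
apply: count_mem_uniq => u; rewrite count_parts //.
have : u \notin minus_part U :&: plus_part U by rewrite e inE.
by rewrite mem_parts // in_setI in_setU; do 2![case: (u \in _)].
Qed.

Lemma strictly_increasing_twice m (U : seq 'I_m) :
  strictly_increasing U -> at_most_twice U.
Proof.
rewrite /strictly_increasing ltn_sorted_uniq_leq => /andP[uU sU]; rewrite /at_most_twice sU.
apply/forallP => u; rewrite count_uniq_mem; first by case: (u \in U).
by move: uU; rewrite map_inj_uniq //; apply: val_inj.
Qed.

Lemma cochain_tensor_sums (a b : cochain X) (I J : Type) (r : seq I) (r' : seq J)
    (y : I -> simplex X) (z : J -> simplex X) :
  cochain_tensor a b (tensor (\sum_(i <- r) << y i >>) (\sum_(j <- r') << z j >>)) =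
  \sum_(i <- r) \sum_(j <- r') a << y i >> * b << z j >>.
Proof.
rewrite /tensor !linear_sum; apply: eq_bigr => i _.
rewrite /= liftU scale1r !linear_sum; apply: eq_bigr => j _.
by rewrite /= liftU scale1r; apply: cochain_tensorE.
Qed.

Lemma cup_steenrod i (a b : cochain X) :
  cup i a b =1 dual_operation (steenrod_nabla X i) a b.
Proof.
apply: cochain_ext => m x; rewrite cup_sequences.
rewrite -[RHS]/(cochain_tensor a b (steenrod_nabla X i _)) /steenrod_nabla chain_liftE.
case: (m%:Z - 1 - i) => [q|q]; last by rewrite linear0.
rewrite linear_sum [RHS]big_mkcond [LHS]big_mkcond; apply: eq_bigr => U _ /=.
case: ifP => [twU|ntwU]; last first.
  by case: ifP => // /strictly_increasing_twice; rewrite ntwU.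
rewrite strictly_increasingE //; set A := minus_part U; set B := plus_part U.
have -> : cochain_tensor a b (tensor (face_chain F2 A x) (face_chain F2 B x)) =
    \sum_(s <- fibre_seq (bd X (face_of A)) x) \sum_(t <- fibre_seq (bd X (face_of B)) x)
      value a (target s) * value b (target t).
  by rewrite /face_chain !chain_ofE cochain_tensor_sums.
transitivity (\sum_(s <- fibre_seq (bd X (face_of A)) x) \sum_(t <- fibre_seq (bd X (face_of B)) x)
      (A :&: B == set0)%:R * (value a (target s) * value b (target t))).
  rewrite big_seq [RHS]big_seq; apply: eq_bigr => s; rewrite mem_fibre_seq => /eqP sx.
  rewrite big_seq [RHS]big_seq; apply: eq_bigr => t; rewrite mem_fibre_seq => /eqP tx.
  have st : source s = source t by rewrite sx tx.
  rewrite card_positive_chains //; congr (_ * _).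
  have [->|C0] := eqVneq (A :&: B) set0; first by rewrite chain_count0 agree0.
  rewrite chain_countE // /signed_good set0U [agree s t (A :&: B)]agree_simplicial ?andbF ?mul0r //.
    exact: subsetIl.
  exact: subsetIr.
case: ifP => _.
  by apply: eq_bigr => s _; apply: eq_bigr => t _; rewrite mul1r.
by rewrite big1 // => s _; rewrite big1 // => t _; rewrite mul0r.
Qed.

End Steenrod.

Theorem theorem1 (X : ordered_object) :
  stable_symmetric_multiplication (@cup X) /\
  (forall (Y : ordered_object) (f : object_map X Y),
     free_map f -> order_preserving f ->
     forall (i : int) (a b : cochain Y),
       pullback f (cup i a b) =1 cup i (pullback f a) (pullback f b)) /\
  (semi_simplicial_set X ->
     forall (i : int) (a b : cochain X),
       cup i a b =1 dual_operation (steenrod_nabla X i) a b).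
Proof.
split; [exact: cup_stable_symmetric|split].
  by move=> Y f f_free f_ord i a b; apply: pullback_cup.
by move=> Xsss i a b; apply: cup_steenrod.
Qed.
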